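(* Let $N\ge0$ be an integer, $\omega_N(x,\xi)=\langle(x,\xi)\rangle^N$, let $$\mathfrak a(x,\xi)=\sum_{|\alpha+\beta|\le N}c(\alpha,\beta)x^\alpha\xi^\beta,\qquad\mathfrak a_p(x,\xi)=\sum_{|\alpha+\beta|=N}c(\alpha,\beta)x^\alpha\xi^\beta,\qquad x,\xi\in\mathbf R^d,$$ for some $c(\alpha,\beta)\in\mathbf C$, $\alpha,\beta\in\mathbf N^d$ (so that $\mathfrak a\in\mathrm{Sh}^{(\omega_N)}_1(\mathbf R^{2d})$). Then the following is true: (1) the principal symbol $a_p(z,w)$ of $\mathsf S_{\mathfrak V}\mathfrak a$ is given by $$a_p(z,w)=2^{-\frac N2}\sum_{|\alpha+\beta|=N}c(\alpha,\beta)\,i^{|\beta|}(z+\overline w)^\alpha(z-\overline w)^\beta;$$ (2) $\mathfrak a$ is elliptic in $\mathrm{Sh}^{(\omega_N)}_1(\mathbf R^{2d})$ if and only if $a_p$ is elliptic in $\widehat{\mathcal A}{}^{(\omega_N)}_{\mathrm{Sh},1}(\mathbf C^{2d})$; (3) $\mathfrak a_p(x,\xi)>0$ for every $(x,\xi)\ne(0,0)$ if and only if $a_p(z,z)>0$ for every $z\ne0$.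
   Context: Notation: $\langle x\rangle=(1+|x|^2)^{1/2}$, also for complex vectors; $(z,w)=\sum_jz_j\overline{w_j}$; $\mathbf C^d\simeq\mathbf R^{2d}$ via $x+i\xi\leftrightarrow(x,\xi)$; $d\lambda$ is Lebesgue measure; $\lesssim,\gtrsim$ are inequalities up to positive constants independent of the variables (possibly depending on multi-indices and the decay exponent). For a weight $\omega$, $\mathrm{Sh}^{(\omega)}_1(\mathbf R^{2d})$ is the set of $f\in C^\infty(\mathbf R^{2d})$ with $|\partial^\alpha f|\lesssim\omega\langle\cdot\rangle^{-|\alpha|}$ for all $\alpha\in\mathbf N^{2d}$. $\widehat A(\mathbf C^{2d})$ is the set of $a(z,w)$ such that $(z,w)\mapsto a(z,\overline w)$ is entire on $\mathbf C^{2d}$; $\widehat{\mathcal A}{}^{(\omega)}_{\mathrm{Sh},1}(\mathbf C^{2d})$ is the set of $a\in\widehat A(\mathbf C^{2d})$ with $|\partial_z^\alpha\overline\partial_w^\beta a(z,w)|\lesssim e^{\frac12|z-w|^2}\omega(\sqrt2\,\overline z)\langle z+w\rangle^{-|\alpha+\beta|}\langle z-w\rangle^{-M}$ for all $\alpha,\beta\in\mathbf N^d$, $M\ge0$. Ellipticity: $\mathfrak a$ is elliptic in $\mathrm{Sh}^{(\omega_N)}_1(\mathbf R^{2d})$ if for some $R>0$, $|\mathfrak a(x,\xi)|\gtrsim\omega_N(x,\xi)$ when $|(x,\xi)|\ge R$; $a$ is elliptic in $\widehat{\mathcal A}{}^{(\omega_N)}_{\mathrm{Sh},1}(\mathbf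 C^{2d})$ if for some $R>0$, $|a(z,z)|\gtrsim\omega_N(\sqrt2\,\overline z)$ when $|z|\ge R$. Weyl quantization: $\mathrm{Op}^w(\mathfrak a)f(x)=(2\pi)^{-d}\iint\mathfrak a(\frac{x+y}2,\xi)f(y)e^{i\langle x-y,\xi\rangle}dy\,d\xi$ (oscillatory integral). Bargmann transform: $\mathfrak V_df(z)=\pi^{-d/4}\int_{\mathbf R^d}\exp(-\frac12(\langle z,z\rangle+|y|^2)+2^{1/2}\langle z,y\rangle)f(y)\,dy$, $\langle z,w\rangle=\sum z_jw_j$, extended to $\mathscr S'(\mathbf R^d)$. Wick operator: $\mathrm{Op}_{\mathfrak V}(a)F(z)=\pi^{-d}\int_{\mathbf C^d}a(z,w)F(w)e^{(z-w,w)}d\lambda(w)$ for entire $F$ with $|F(z)|\lesssim e^{r|z|}$ for some $r>0$. The Bargmann assignment $\mathsf S_{\mathfrak V}\mathfrak a$ is the unique $a\in\widehat A(\mathbf C^{2d})$ with $\mathrm{Op}_{\mathfrak V}(a)=\mathfrak V_d\circ\mathrm{Op}^w(\mathfrak a)\circ\mathfrak V_d^{-1}$ on such $F$. For $\mathfrak a$ a polynomial of degree at most $N$, $\mathsf S_{\mathfrak V}\mathfrak a$ is a polynomial in $z$ and $\overline w$ of degree at most $N$; its principal symbol $a_p$ is its part homogeneous of degree $N$ in $(z,\overline w)$. *)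

(* Defs.v *)
From HB Require Import structures.
From mathcomp Require Import all_boot all_order all_algebra.
From mathcomp Require Import complex.
From mathcomp Require Import all_classical all_reals all_analysis.

Set Implicit Arguments.
Unset Strict Implicit.
Unset Printing Implicit Defensive.

Import Order.TTheory GRing.Theory Num.Theory.
Import numFieldNormedType.Exports.

Local Open Scope classical_set_scope.
Local Open Scope ring_scope.
Local Open Scope complex_scope.

Section PowerMeasure.
Context disp (T : measurableType disp) (R : realType).
Variable mu : {sigma_finite_measure set T -> \bar R}.

Definition tuple_cons n (p : T * n.-tuple T) : n.+1.-tuple T :=
  [tuple of p.1 :: p.2].

Definition tuple_uncons n (t : n.+1.-tuple T) : T * n.-tuple T :=
  (thead t, [tuple of behead t]).

Lemma tuple_consK n : cancel (@tuple_cons n) (@tuple_uncons n).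
Proof. by case=> x t; congr pair; apply/val_inj. Qed.

Lemma measurable_tuple_cons n :
  measurable_fun [set: T * n.-tuple T] (@tuple_cons n).
Proof. exact: (measurable_cons measurable_fst measurable_snd). Qed.

Lemma measurable_tuple_uncons n :
  measurable_fun [set: n.+1.-tuple T] (@tuple_uncons n).
Proof.
by apply: measurable_fun_pair; [exact: measurable_tnth|exact: measurable_behead].
Qed.

Section Step.
Variables (n : nat) (m : {sigma_finite_measure set (n.-tuple T) -> \bar R}).

Definition power_step : set (n.+1.-tuple T) -> \bar R :=
  pushforward (mu \x m)%E (@tuple_cons n).

HB.instance Definition _ := Measure.copy power_step
  (measure_function_pushforward__canonical__measure_function_Measure
    (mu \x m)%E (@measurable_tuple_cons n)).

Lemma power_step_sigma_finite : sigma_finite setT power_step.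
Proof.
have /sigma_finiteP[F [TF ndF Foo]] := sigma_finiteT mu.
have /sigma_finiteP[G [TG ndG Goo]] := sigma_finiteT m.
exists (fun k => @tuple_uncons n @^-1` (F k `*` G k)).
  rewrite -preimage_bigcup (_ : \bigcup_k _ = setT) ?preimage_setT//.
  apply/seteqP; split=> // -[x y] _.
  have [i _ Fx] : (\bigcup_k F k) x by rewrite -TF.
  have [j _ Gy] : (\bigcup_k G k) y by rewrite -TG.
  exists (maxn i j) => //; split => /=.
    by move: x Fx; exact/subsetPset/ndF/leq_maxl.
  by move: y Gy; exact/subsetPset/ndG/leq_maxr.
move=> k; have [mF Fk] := Foo k; have [mG Gk] := Goo k; split.
  by rewrite -[X in measurable X]setTI; apply: measurable_tuple_uncons => //;
     exact: measurableX.
rewrite /power_step /pushforward (_ : _ @^-1` _ = F k `*` G k); last first.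
  by apply/funext => p; rewrite /preimage /mkset tuple_consK.
by rewrite product_measure1E// lte_mul_pinfty// ge0_fin_numE.
Qed.

HB.instance Definition _ :=
  @Measure_isSigmaFinite.Build _ _ _ power_step power_step_sigma_finite.

End Step.

(* The n-fold product measure mu \x ... \x mu, on n-tuples. *)
Fixpoint power_measure n : {sigma_finite_measure set (n.-tuple T) -> \bar R} :=
  if n is k.+1 then power_step (power_measure k)
  else \d_([tuple] : 0.-tuple T).

End PowerMeasure.

Definition lebesgue_tuple (R : realType) n :=
  power_measure (@lebesgue_measure R) n.

Section ComplexValued.
Variable R : realType.
Local Notation C := R[i].
Local Notation Re := (@complex.Re R).
Local Notation Im := (@complex.Im R).

Definition cexp (z : C) : C :=
  (expR (Re z))%:C * (cos (Im z) +i* sin (Im z)).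

Definition cintegrable dp (T : measurableType dp)
    (mu : {measure set T -> \bar R}) (f : T -> C) : Prop :=
  mu.-integrable setT (fun t => (Re (f t))%:E) /\
  mu.-integrable setT (fun t => (Im (f t))%:E).

Definition cintegral dp (T : measurableType dp)
    (mu : {measure set T -> \bar R}) (f : T -> C) : C :=
  (\int[mu]_t Re (f t)) +i* (\int[mu]_t Im (f t)).

Variable d : nat.

Definition rvec (t : d.-tuple (measurableTypeR R)) : 'rV[R]_d :=
  \row_j tnth t j.

Definition vecC (x : 'rV[R]_d) : 'rV[C]_d := map_mx (real_complex R) x.
Definition vecReIm (x xi : 'rV[R]_d) : 'rV[C]_d := \row_j (x 0 j +i* xi 0 j).
Definition vecRe (z : 'rV[C]_d) : 'rV[R]_d := map_mx Re z.
Definition vecIm (z : 'rV[C]_d) : 'rV[R]_d := map_mx Im z.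
Definition vconj (z : 'rV[C]_d) : 'rV[C]_d := map_mx conjc z.

Definition bil (z w : 'rV[C]_d) : C := \sum_j z 0 j * w 0 j.
Definition herm (z w : 'rV[C]_d) : C := \sum_j z 0 j * conjc (w 0 j).

Definition sqnorm (x : 'rV[R]_d) : R := \sum_j x 0 j ^+ 2.

(* Euclidean norm; the norm `|x| of the library on matrices is the sup norm. *)
Definition norm2 (x xi : 'rV[R]_d) : R := Num.sqrt (sqnorm x + sqnorm xi).
Definition normC2 (z : 'rV[C]_d) : R := norm2 (vecRe z) (vecIm z).

Definition omega (N : nat) (x xi : 'rV[R]_d) : R :=
  Num.sqrt (1 + norm2 x xi ^+ 2) ^+ N.

Definition integralR (f : 'rV[R]_d -> C) : C :=
  cintegral (@lebesgue_tuple R d) (fun t => f (rvec t)).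

(* d lambda on C^d, through x + i xi <-> (x, xi). *)
Definition lebesgueC := (@lebesgue_tuple R d \x @lebesgue_tuple R d)%E.
Definition integrableC (F : 'rV[C]_d -> C) : Prop :=
  cintegrable lebesgueC (fun t => F (vecReIm (rvec t.1) (rvec t.2))).
Definition integralC (F : 'rV[C]_d -> C) : C :=
  cintegral lebesgueC (fun t => F (vecReIm (rvec t.1) (rvec t.2))).

Definition partial (s : seq 'I_d) (g : 'rV[R]_d -> R) : 'rV[R]_d -> R :=
  foldr (fun j h => 'D_(delta_mx 0 j) h) g s.

Definition schwartzR (g : 'rV[R]_d -> R) : Prop := forall s : seq 'I_d,
  (forall x, differentiable (partial s g) x) /\
  (forall k : nat, exists M : R, forall x,
     Num.sqrt (1 + sqnorm x) ^+ k * `|partial s g x| <= M).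

Definition schwartz (f : 'rV[R]_d -> C) : Prop :=
  schwartzR (Re \o f) /\ schwartzR (Im \o f).

(* The oscillatory integral of the Weyl quantization, for f Schwartz: both
   successive integrals converge absolutely when the symbol is a polynomial. *)
Definition weyl_op (a : 'rV[R]_d -> 'rV[R]_d -> C) (f : 'rV[R]_d -> C)
    (x : 'rV[R]_d) : C :=
  (((2 * pi) ^+ d)^-1)%:C *
  integralR (fun xi => integralR (fun y =>
    a (2^-1 *: (x + y)) xi * f y * cexp ('i%C * bil (vecC (x - y)) (vecC xi)))).

Definition bargmann (f : 'rV[R]_d -> C) (z : 'rV[C]_d) : C :=
  (pi `^ (- (d%:R / 4)))%:C *
  integralR (fun y =>
    cexp (- 2^-1 * (bil z z + (sqnorm y)%:C)
          + (Num.sqrt 2)%:C * bil z (vecC y)) * f y).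

Definition wick_integrand (a : 'rV[C]_d -> 'rV[C]_d -> C) (F : 'rV[C]_d -> C)
    (z w : 'rV[C]_d) : C := a z w * F w * cexp (herm (z - w) w).

Definition wick_op (a : 'rV[C]_d -> 'rV[C]_d -> C) (F : 'rV[C]_d -> C)
    (z : 'rV[C]_d) : C :=
  ((pi ^+ d)^-1)%:C * integralC (wick_integrand a F z).

End ComplexValued.

(* Complex differentiability everywhere.  Stated over an arbitrary K, since the
   library puts no topology on R[i] itself, only on the carrier of a
   numFieldType. *)
Definition entire (K : numFieldType) (n : nat) (F : 'rV[K]_n -> K) : Prop :=
  forall z, differentiable (F : 'rV[K]_n -> K^o) z.

Section Assignment.
Variables (R : realType) (d : nat).
Local Notation C := R[i].

Definition hatA (a : 'rV[C]_d -> 'rV[C]_d -> C) : Prop :=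
  entire (fun u : 'rV[C]_(d + d) => a (lsubmx u) (vconj (rsubmx u))).

Definition entire_exp (F : 'rV[C]_d -> C) : Prop :=
  entire F /\
  exists2 r : R, 0 < r &
    exists M : R, forall z, `|F z| <= (M * expR (r * normC2 z))%:C.

(* f is the inverse Bargmann transform of F.  When F is entire of exponential
   growth, its unique tempered preimage is a Schwartz function. *)
Definition bargmann_preimage (F : 'rV[C]_d -> C) (f : 'rV[R]_d -> C) : Prop :=
  schwartz f /\ bargmann f = F.

(* b is the Bargmann assignment of the symbol a. *)
Definition bargmann_assignment (a : 'rV[R]_d -> 'rV[R]_d -> C)
    (b : 'rV[C]_d -> 'rV[C]_d -> C) : Prop :=
  hatA b /\
  forall F, entire_exp F ->
    (forall z, integrableC (wick_integrand b F z)) /\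
    (forall f, bargmann_preimage F f ->
       wick_op b F = bargmann (weyl_op a f)).

End Assignment.

Section Polynomials.
Variables (R : realType) (d N : nat).
Local Notation C := R[i].

(* Multi-indices with entries at most N, enough for those of length <= N. *)
Definition mindex := {ffun 'I_d -> 'I_N.+1}.
Definition mlen (al : mindex) : nat := \sum_j al j.
Definition mpow (z : 'rV[C]_d) (al : mindex) : C := \prod_j z 0 j ^+ al j.

Definition sum_le (c : mindex -> mindex -> C) (u v : 'rV[C]_d) : C :=
  \sum_al \sum_(be | (mlen al + mlen be <= N)%N)
     c al be * mpow u al * mpow v be.
Definition sum_top (c : mindex -> mindex -> C) (u v : 'rV[C]_d) : C :=
  \sum_al \sum_(be | (mlen al + mlen be == N)%N)
     c al be * mpow u al * mpow v be.

(* a is a polynomial of degree at most N in z and the conjugate of w, and ap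
   is its part homogeneous of degree N. *)
Definition principal_symbol (a ap : 'rV[C]_d -> 'rV[C]_d -> C) : Prop :=
  exists c : mindex -> mindex -> C,
    (forall z w, a z w = sum_le c z (vconj w)) /\
    (forall z w, ap z w = sum_top c z (vconj w)).

End Polynomials.

Section Ellipticity.
Variables (R : realType) (d : nat).
Local Notation C := R[i].

Definition elliptic_Sh (om : 'rV[R]_d -> 'rV[R]_d -> R)
    (a : 'rV[R]_d -> 'rV[R]_d -> C) : Prop :=
  exists2 r : R, 0 < r & exists2 k : R, 0 < k &
    forall x xi, r <= norm2 x xi -> (k * om x xi)%:C <= `|a x xi|.

Definition elliptic_A (om : 'rV[R]_d -> 'rV[R]_d -> R)
    (a : 'rV[C]_d -> 'rV[C]_d -> C) : Prop :=
  exists2 r : R, 0 < r & exists2 k : R, 0 < k &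
    forall z, r <= normC2 z ->
      let z' := (Num.sqrt 2)%:C *: vconj z in
      (k * om (vecRe z') (vecIm z'))%:C <= `|a z z|.

End Ellipticity.

(* Main.v *)
(* For u in C^d, the coherent state f_u has Bargmann transform z |-> e^(z.u).
   The Wick operator with symbol b(z, w) and the conjugated Weyl operator both
   send this exponential to itself times a polynomial in (z, u), so hypothesis
   [hb] equates two polynomials.  Both are iterated Gaussian integrals of
   products of affine forms, and a Gaussian integral with complex linear term
   is computed by moving the contour to its complex center: the affine forms
   are evaluated there, up to terms of lower total degree.  On the Wick side
   the centers give b(z, conj u) at top order; on the Weyl side they give
   x = (z + u) / sqrt 2 and xi = i (z - u) / sqrt 2, which is (1).  On the
   diagonal this reads bp(z, z) = ap(sqrt 2 conj z), whence (2) and (3), since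
   a - ap has lower order. *)

Require Import Defs.
From HB Require Import structures.
From mathcomp Require Import all_boot all_order all_algebra.
From mathcomp Require Import complex.
From mathcomp Require Import all_classical all_reals all_analysis measurable_realfun.
From mathcomp Require Import ring lra.

Set Implicit Arguments.
Unset Strict Implicit.
Unset Printing Implicit Defensive.

Import Order.TTheory GRing.Theory Num.Theory.
Import numFieldNormedType.Exports.

Local Open Scope ring_scope.
Local Open Scope complex_scope.

(** * Complex calculus along the real line *)

(** The parameter [u] is complex and independent of [z]: it takes the place of the conjugate of [w],
    so one family of test functions recovers a polynomial in two groups of variables. On this family
    everything factors over coordinates, so the analysis is one-dimensional: three nested Gaussian
    integrals on the Weyl side (in [y], [xi], [x]), two on the Wick side (imaginary, then real part
    of [w]). The lower-order terms involve Gaussian moments and are never computed. What has to be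
    carried through is that each integral preserves the leading monomial, and that the resulting
    polynomial is chosen once for all values of the parameters. Homogeneous parts are then compared
    along [t |-> (t z, t u)], as coefficients of [t^N]. Contours are moved by differentiating in the
    size of the translation, which needs only real calculus: a dominated derivative and the
    vanishing of the integral of a derivative. The hypothesis on [b] may be tested on [e^(z.u)] only
    once this function is known to be entire of exponential growth and its preimage to be
    Schwartz. *)

Section ComplexCalculus.
Variable R : realType.
Local Notation C := R[i].
Local Notation Re := (@complex.Re R).
Local Notation Im := (@complex.Im R).
Local Notation normc := (@ComplexField.Normc.normc R).

Lemma ReD (z w : C) : Re (z + w) = Re z + Re w.
Proof. by case: z w => ? ? []. Qed.

Lemma ImD (z w : C) : Im (z + w) = Im z + Im w.
Proof. by case: z w => ? ? []. Qed.

Lemma ReN (z : C) : Re (- z) = - Re z.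
Proof. by case: z. Qed.

Lemma ImN (z : C) : Im (- z) = - Im z.
Proof. by case: z. Qed.

Lemma ReM (z w : C) : Re (z * w) = Re z * Re w - Im z * Im w.
Proof. by case: z w => ? ? []. Qed.

Lemma ImM (z w : C) : Im (z * w) = Re z * Im w + Im z * Re w.
Proof. by case: z w => ? ? []. Qed.

Lemma complexP (z w : C) : Re z = Re w -> Im z = Im w -> z = w.
Proof. by case: z w => ? ? [? ?] /= -> ->. Qed.

Definition complex_partsE := (ReD, ImD, ReN, ImN, ReM, ImM).

Lemma cexpD (z w : C) : cexp (z + w) = cexp z * cexp w.
Proof.
by apply: complexP; rewrite /cexp !complex_partsE /= expRD cosD sinD; ring.
Qed.

Lemma cexp0 : cexp (0 : C) = 1.
Proof. by rewrite /cexp /= expR0 cos0 sin0; apply: complexP => /=; ring. Qed.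

Lemma cexp_sum (I : Type) (r : seq I) (P : pred I) (F : I -> C) :
  cexp (\sum_(i <- r | P i) F i) = \prod_(i <- r | P i) cexp (F i).
Proof. by apply: (big_morph _ cexpD cexp0). Qed.

Lemma cexp_neq0 (z : C) : cexp z != 0.
Proof.
apply/negP => /eqP z0; have := cexpD z (- z).
by rewrite subrr cexp0 z0 mul0r => /eqP; rewrite oner_eq0.
Qed.

Lemma normc_ge0 (z : C) : 0 <= normc z.
Proof. by case: z => a b /=; exact: sqrtr_ge0. Qed.

Lemma sqr_normc (z : C) : normc z ^+ 2 = Re z ^+ 2 + Im z ^+ 2.
Proof. by case: z => a b /=; rewrite sqr_sqrtr// addr_ge0// sqr_ge0. Qed.

Lemma normc_cexp (z : C) : normc (cexp z) = expR (Re z).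
Proof.
apply/eqP; rewrite -(@eqrXn2 _ 2)// ?normc_ge0 ?expR_ge0//; apply/eqP.
rewrite sqr_normc /cexp !complex_partsE /= !mul0r subr0 addr0 !exprMn -mulrDr.
by rewrite cos2Dsin2 mulr1.
Qed.

Lemma normcX (z : C) n : normc (z ^+ n) = normc z ^+ n.
Proof.
elim: n => [|n IH]; first by rewrite !expr0 ComplexField.Normc.normc1.
by rewrite !exprS ComplexField.Normc.normcM IH.
Qed.

Lemma normRe_le (z : C) : `|Re z| <= normc z.
Proof.
rewrite -(@ler_pXn2r _ 2)// ?nnegrE ?normc_ge0// sqr_normc real_normK ?num_real//.
by rewrite lerDl sqr_ge0.
Qed.

Lemma normIm_le (z : C) : `|Im z| <= normc z.
Proof.
rewrite -(@ler_pXn2r _ 2)// ?nnegrE ?normc_ge0// sqr_normc real_normK ?num_real//.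
by rewrite lerDr sqr_ge0.
Qed.

Lemma normc_le (z : C) : normc z <= `|Re z| + `|Im z|.
Proof.
rewrite -(@ler_pXn2r _ 2)// ?nnegrE ?normc_ge0 ?addr_ge0// sqr_normc sqrrD.
rewrite !real_normK ?num_real// addrAC lerDl mulrn_wge0// mulr_ge0//.
Qed.

Lemma normc_real (x : R) : normc x%:C = `|x|.
Proof. by rewrite /= expr0n /= addr0 sqrtr_sqr. Qed.

(* Complex-valued functions of a real variable; the library has no topology on
   [R[i]] seen as a real normed space. *)
Definition is_cderive (x : R) (f : R -> C) (df : C) :=
  is_derive x 1 (fun t => Re (f t)) (Re df) /\
  is_derive x 1 (fun t => Im (f t)) (Im df).

Lemma is_cderive_eq x f df df' : is_cderive x f df -> df = df' ->
  is_cderive x f df'.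
Proof. by move=> ? <-. Qed.

Lemma is_cderive_cst x (c : C) : is_cderive x (fun=> c) 0.
Proof. by split; exact: is_derive_cst. Qed.

Lemma is_cderiveD x f g df dg : is_cderive x f df -> is_cderive x g dg ->
  is_cderive x (fun t => f t + g t) (df + dg).
Proof.
move=> [f1 f2] [g1 g2]; split.
  under eq_fun do rewrite ReD.
  by rewrite ReD; exact: is_deriveD.
under eq_fun do rewrite ImD.
by rewrite ImD; exact: is_deriveD.
Qed.

Lemma is_cderiveM x f g df dg : is_cderive x f df -> is_cderive x g dg ->
  is_cderive x (fun t => f t * g t) (df * g x + f x * dg).
Proof.
move=> [f1 f2] [g1 g2]; split.
  under eq_fun do rewrite ReM.
  apply: is_derive_eq.
  by rewrite /= !complex_partsE /GRing.scale /=; ring.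
under eq_fun do rewrite ImM.
apply: is_derive_eq.
by rewrite /= !complex_partsE /GRing.scale /=; ring.
Qed.

Lemma is_cderiveX x f df n : is_cderive x f df ->
  is_cderive x (fun t => f t ^+ n) (n%:R * f x ^+ n.-1 * df).
Proof.
move=> fd; elim: n => [|n IH].
  by apply: is_cderive_eq (is_cderive_cst _ _) _; rewrite !mul0r.
under eq_fun do rewrite exprS.
apply: is_cderive_eq (is_cderiveM fd IH) _.
case: n {IH} => [|n]; first by rewrite !expr0 /=; ring.
by rewrite /= exprS -[n.+2]addn1 natrD; ring.
Qed.

Lemma is_cderive_cexp x f df : is_cderive x f df ->
  is_cderive x (fun t => cexp (f t)) (df * cexp (f x)).
Proof.
move=> [f1 f2].
have e1 : is_derive x 1 (fun t => expR (Re (f t))) (expR (Re (f x)) * Re df).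
  by apply: is_derive_eq; rewrite /GRing.scale /= mulrC.
have e2 : is_derive x 1 (fun t => cos (Im (f t))) (- sin (Im (f x)) * Im df).
  by apply: is_derive_eq; rewrite /GRing.scale /= mulrC.
have e3 : is_derive x 1 (fun t => sin (Im (f t))) (cos (Im (f x)) * Im df).
  by apply: is_derive_eq; rewrite /GRing.scale /= mulrC.
split.
  have -> : (fun t => Re (cexp (f t))) =
      (fun t => expR (Re (f t)) * cos (Im (f t))).
    by apply/funext => t; rewrite /cexp !complex_partsE /=; ring.
  apply: is_derive_eq.
  by rewrite /cexp !complex_partsE /= /GRing.scale /=; ring.
have -> : (fun t => Im (cexp (f t))) =
    (fun t => expR (Re (f t)) * sin (Im (f t))).
  by apply/funext => t; rewrite /cexp !complex_partsE /=; ring.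
apply: is_derive_eq.
by rewrite /cexp !complex_partsE /= /GRing.scale /=; ring.
Qed.

Lemma is_cderive_affine x (a b : C) : is_cderive x (fun t => a + t%:C * b) b.
Proof.
split.
  have -> : (fun t : R => Re (a + t%:C * b)) = (fun t => Re a + t * Re b).
    by apply/funext => t; rewrite !complex_partsE /=; ring.
  by apply: is_derive_eq; rewrite /GRing.scale /=; ring.
have -> : (fun t : R => Im (a + t%:C * b)) = (fun t => Im a + t * Im b).
  by apply/funext => t; rewrite !complex_partsE /=; ring.
by apply: is_derive_eq; rewrite /GRing.scale /=; ring.
Qed.

End ComplexCalculus.

(** * Complex-valued integrals *)

Section ComplexIntegral.
Context dp (T : measurableType dp) (R : realType).
Variable mu : {measure set T -> \bar R}.
Local Notation C := R[i].
Local Notation Re := (@complex.Re R).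
Local Notation Im := (@complex.Im R).
Implicit Types f g : T -> C.

Lemma cintegrableD f g : cintegrable mu f -> cintegrable mu g ->
  cintegrable mu (fun t => f t + g t).
Proof.
move=> [f1 f2] [g1 g2]; split.
  under eq_fun do rewrite ReD EFinD.
  exact: integrableD.
under eq_fun do rewrite ImD EFinD.
exact: integrableD.
Qed.

Lemma cintegralD f g : cintegrable mu f -> cintegrable mu g ->
  cintegral mu (fun t => f t + g t) = cintegral mu f + cintegral mu g.
Proof.
move=> [f1 f2] [g1 g2]; apply: complexP; rewrite complex_partsE /=.
  under eq_Rintegral do rewrite ReD.
  exact: RintegralD.
under eq_Rintegral do rewrite ImD.
exact: RintegralD.
Qed.

Lemma cintegrableZ (c : C) f : cintegrable mu f ->
  cintegrable mu (fun t => c * f t).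
Proof.
move=> [f1 f2]; split.
  under eq_fun do rewrite ReM EFinB !EFinM.
  by apply: integrableB => //; exact: integrableZl.
under eq_fun do rewrite ImM EFinD !EFinM.
by apply: integrableD => //; exact: integrableZl.
Qed.

Lemma cintegralZ (c : C) f : cintegrable mu f ->
  cintegral mu (fun t => c * f t) = c * cintegral mu f.
Proof.
move=> [f1 f2].
have h (k : R) (h : T -> R) : mu.-integrable setT (fun t => (h t)%:E) ->
    mu.-integrable setT (EFin \o (fun t => k * h t)).
  move=> hi; have := integrableZl measurableT k hi.
  by under eq_fun do rewrite -EFinM.
apply: complexP; rewrite complex_partsE /=.
  under eq_Rintegral do rewrite ReM.
  by rewrite (RintegralB measurableT (h _ _ f1) (h _ _ f2)) !RintegralZl.
under eq_Rintegral do rewrite ImM.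
by rewrite (RintegralD measurableT (h _ _ f2) (h _ _ f1)) !RintegralZl.
Qed.

Lemma cintegrable0 : cintegrable mu (fun=> 0).
Proof. by split; exact: integrable0. Qed.

Lemma cintegral0 : cintegral mu (fun=> 0) = 0.
Proof. by apply: complexP; rewrite /= /Rintegral integral0. Qed.

Let sum_nil (I : Type) (P : pred I) (F : I -> T -> C) :
  (fun t => \sum_(i <- [::] | P i) F i t) = (fun=> 0).
Proof. by apply/funext => t; rewrite big_nil. Qed.

Let sum_cons (I : Type) i (r : seq I) (P : pred I) (F : I -> T -> C) :
  (fun t => \sum_(i <- i :: r | P i) F i t) =
  if P i then (fun t => F i t + \sum_(i <- r | P i) F i t)
  else (fun t => \sum_(i <- r | P i) F i t).
Proof. by case: ifP => Pi; apply/funext => t; rewrite big_cons Pi. Qed.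

Lemma cintegrable_sum (I : Type) (r : seq I) (P : pred I) (F : I -> T -> C) :
  (forall i, P i -> cintegrable mu (F i)) ->
  cintegrable mu (fun t => \sum_(i <- r | P i) F i t).
Proof.
move=> iF; elim: r => [|i r IH]; first by rewrite sum_nil; exact: cintegrable0.
by rewrite sum_cons; case: ifP => // Pi; apply: cintegrableD => //; exact: iF.
Qed.

Lemma cintegral_sum (I : Type) (r : seq I) (P : pred I) (F : I -> T -> C) :
  (forall i, P i -> cintegrable mu (F i)) ->
  cintegral mu (fun t => \sum_(i <- r | P i) F i t) =
  \sum_(i <- r | P i) cintegral mu (F i).
Proof.
move=> iF; elim: r => [|i r IH]; first by rewrite sum_nil big_nil cintegral0.
rewrite sum_cons big_cons; case: ifP => // Pi.
by rewrite cintegralD ?IH//; [exact: iF|exact: cintegrable_sum].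
Qed.

End ComplexIntegral.

(** * Real Gaussian integrals and integrals of derivatives *)

Section Gaussian.
Local Open Scope classical_set_scope.
Variable R : realType.
Local Notation C := R[i].
Local Notation Re := (@complex.Re R).
Local Notation Im := (@complex.Im R).
Local Notation normc := (@ComplexField.Normc.normc R).
Local Notation mu := (@lebesgue_measure R).

(** Up to a constant factor the integrand is the normal density with mean 0 and variance
    [1 / (2 l)], whose total mass is 1. *)
Lemma integral_gauss (l : R) : 0 < l ->
  mu.-integrable setT (fun y => (expR (- (l * y ^+ 2)))%:E) /\
  \int[mu]_y expR (- (l * y ^+ 2)) = Num.sqrt (pi / l).
Proof.
move=> l0; set s := (Num.sqrt (l *+ 2))^-1.
have s0 : s != 0 by rewrite invr_neq0// gt_eqF// sqrtr_gt0 mulrn_wgt0.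
have s2 : s ^+ 2 = (l *+ 2)^-1 by rewrite exprVn sqr_sqrtr// mulrn_wge0// ltW.
have l0' : l != 0 by rewrite gt_eqF.
have peak0 : normal_peak s != 0 by rewrite gt_eqF// normal_peak_gt0.
have peakE : (normal_peak s)^-1 = Num.sqrt (pi / l).
  rewrite /normal_peak invrK s2; congr Num.sqrt.
  move: (pi : R) => p; rewrite -mulrnAr -(mulr_natr l) -(mulr_natr p).
  by field.
have eE (y : R) : expR (- (l * y ^+ 2)) =
    (normal_peak s)^-1 * normal_pdf 0 s y.
  rewrite normal_pdfE// mulrA mulVf// mul1r /normal_fun; congr expR.
  rewrite subr0 s2 -(mulr_natr (_ ^-1)) -(mulr_natr l).
  by field.
have ipdf := integrable_normal_pdf (0 : R) s.
split.
  under eq_fun do rewrite eE EFinM.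
  exact: integrableZl.
under eq_Rintegral do rewrite eE.
rewrite RintegralZl//.
by rewrite /Rintegral integral_normal_pdf /= mulr1 peakE.
Qed.

Lemma gauss_bounded_cintegrable (e K : R) (f : R -> C) : 0 < e ->
  measurable_fun setT (fun y => Re (f y)) ->
  measurable_fun setT (fun y => Im (f y)) ->
  (forall y, normc (f y) <= K * expR (- (e * y ^+ 2))) ->
  cintegrable mu f.
Proof.
move=> e0 mRe mIm fK.
have [ig _] := integral_gauss e0.
have iK := integrableZl measurableT K ig.
split; apply: le_integrable iK => //.
- exact/measurable_EFinP.
- move=> y _ /=; rewrite lee_fin (le_trans (normRe_le _))//.
  by rewrite (le_trans (fK y))// ler_norm.
- exact/measurable_EFinP.
- move=> y _ /=; rewrite lee_fin (le_trans (normIm_le _))//.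
  by rewrite (le_trans (fK y))// ler_norm.
Qed.

Lemma gauss_cvg0 (e K : R) : 0 < e ->
  (K * expR (- (e * n%:R ^+ 2))) @[n --> \oo] --> (0 : R).
Proof.
move=> e0; rewrite -(mulr0 K); apply: cvgMr.
apply: (@cvg_comp _ _ _ (fun n : nat => e * n%:R ^+ 2) (fun x : R => expR (- x))
  _ +oo%R); last exact: cvgr_expR.
apply/cvgryPge => M; near=> n.
rewrite mulrC -ler_pdivrMr//; apply: (@le_trans _ _ (n%:R : R)).
  by near: n; exact: nbhs_infty_ger.
by rewrite -natrX ler_nat -mulnn leq_pmull//; near: n; exact: nbhs_infty_gt.
Unshelve. all: by end_near. Qed.

(** On a growing symmetric interval the integral of [f] is a difference of values of [F], which tend
    to 0 by the Gaussian bound; dominated convergence passes to the whole line. *)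
Lemma integral_derive_eq0 (F f : R -> R) (e K : R) : 0 < e ->
  (forall y : R, is_derive y 1 F (f y)) -> continuous f ->
  mu.-integrable setT (fun y => (f y)%:E) ->
  (forall y, `|F y| <= K * expR (- (e * y ^+ 2))) ->
  \int[mu]_y f y = 0.
Proof.
move=> e0 dF cf intf FK.
have mf : measurable_fun setT f by exact: continuous_measurable_fun.
(* Half-length [n + 1] rather than [n]: the fundamental theorem of calculus wants a nondegenerate
   interval, also at [n = 0]. *)
pose I n : set R := `[- n.+1%:R, n.+1%:R]%classic.
have intI n : (\int[mu]_y (f \_ (I n) y)%:E =
    (F n.+1%:R - F (- n.+1%:R))%:E)%E.
  rewrite (_ : (fun y => (f \_ (I n) y)%:E) = (EFin \o f) \_ (I n)); last first.
    by rewrite restrict_EFin.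
  rewrite -integral_mkcond /I (@continuous_FTC2 _ f F)//.
  - by rewrite ltrNl (lt_trans _ (ltr0Sn _ _))// oppr_lt0.
  - by apply: continuous_subspaceT.
  - have cF : continuous F.
      move=> x; apply/differentiable_continuous/derivable1_diffP.
      by have := dF x; case.
    split.
    + by move=> x _; have := dF x; case.
    + exact/cvg_at_right_filter/cF.
    + exact/cvg_at_left_filter/cF.
  - by move=> x _; rewrite derive1E; have [_ ->] := dF x.
have [||||| _ _ lim] := @dominated_convergence _ _ _ mu _ measurableT
  (fun n y => (f \_ (I n) y)%:E) (EFin \o f) (fun y => `|f y|%:E).
- move=> n; apply/measurable_EFinP.
  have mI : measurable (I n : set (measurableTypeR R)) by exact: measurable_itv.
  have [+ _] := measurable_restrictT (f : measurableTypeR R -> R) mI.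
  apply.
  exact: measurable_funTS.
- exact/measurable_EFinP.
- apply: aeW => y _.
  apply/fine_cvgP; split; first exact: nearW.
  apply: cvg_near_cst; near=> n => /=.
  rewrite patchE ifT// inE /I /= in_itv /= -ler_norml.
  near: n; exists (Num.truncn `|y|).+1 => // n /= ny.
  apply/ltW/(lt_le_trans (truncnS_gt _)).
  by rewrite ler_nat leqW.
- exact: integrable_norm.
- apply: aeW => y n _ /=; rewrite lee_fin patchE; case: ifP => // _.
  by rewrite normr0.
move: lim; under eq_fun do rewrite intI.
move=> lim.
have l1 : (F n.+1%:R - F (- n.+1%:R)) @[n --> \oo] --> \int[mu]_y f y.
  move: lim; rewrite /= -(fineK (integrable_fin_num measurableT intf)).
  exact: fine_cvg.
have l2 : (F n.+1%:R - F (- n.+1%:R)) @[n --> \oo] --> (0 : R).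
  apply: norm_cvg0.
  apply: (@squeeze_cvgr _ _ _ _ (cst 0)
    (fun n => (K + K) * expR (- (e * n.+1%:R ^+ 2)))).
  - apply: nearW => n; rewrite normr_ge0/= (le_trans (ler_normB _ _))// mulrDl.
    by rewrite lerD// (le_trans (FK _))// sqrrN.
  - exact: cvg_cst.
  - by have := @gauss_cvg0 e (K + K) e0; rewrite -cvg_shiftS.
exact: cvg_unique l1 l2.
Unshelve. all: by end_near. Qed.

End Gaussian.

(** * Gaussian integrals with complex center *)

Section ContourShift.
Local Open Scope classical_set_scope.
Variable R : realType.
Local Notation C := R[i].
Local Notation Re := (@complex.Re R).
Local Notation Im := (@complex.Im R).
Local Notation normc := (@ComplexField.Normc.normc R).
Local Notation mu := (@lebesgue_measure R).

Lemma is_cderive_continuous (f df : R -> C) :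
  (forall x, is_cderive x f (df x)) ->
  continuous (fun t => Re (f t)) /\ continuous (fun t => Im (f t)).
Proof.
move=> fd; split=> x; apply/differentiable_continuous/derivable1_diffP.
  by have [[]] := fd x.
by have [_ []] := fd x.
Qed.

Lemma is_cderive_measurable (f df : R -> C) :
  (forall x, is_cderive x f (df x)) ->
  measurable_fun setT (fun t => Re (f t)) /\
  measurable_fun setT (fun t => Im (f t)).
Proof.
by move=> /is_cderive_continuous[? ?]; split; exact: continuous_measurable_fun.
Qed.

Variable l : R.
Hypothesis l0 : 0 < l.

Definition gaussmon k (w : C) : C := w ^+ k * cexp (- l%:C * w ^+ 2).

(** The derivative of [gaussmon k] in its complex variable. It stays in the family, so the same
    bounds apply to it. At [k = 0] the truncated predecessor is harmless, its coefficient being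
    0. *)
Definition dgaussmon k (w : C) : C :=
  k%:R * gaussmon k.-1 w - 2 * l%:C * gaussmon k.+1 w.

Lemma is_cderive_gaussmon x (w : R -> C) dw k : is_cderive x w dw ->
  is_cderive x (fun t => gaussmon k (w t)) (dw * dgaussmon k (w x)).
Proof.
move=> wd; apply: is_cderive_eq.
  apply: is_cderiveM; first exact: is_cderiveX wd.
  apply: is_cderive_cexp; apply: is_cderiveM; first exact: is_cderive_cst.
  exact: is_cderiveX wd.
by rewrite /dgaussmon /gaussmon /= [w x ^+ k.+1]exprS; ring.
Qed.

(** The moving contour requires a bound uniform in [|t| <= T]. The power is absorbed by
    [|w|^k <= exp (k |w|)] and [k |w| <= k^2 / (2 l) + l |w|^2 / 2]. This leaves
    [- l (Re w)^2 / 2 + 3 l (Im w)^2 / 2] in the exponent, of which [- l y^2 / 4] survives the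
    translation by [t Re s]. *)
Lemma gaussmon_bound k (s : C) (T : R) : exists2 K : R, 0 <= K &
  forall t y : R, `|t| <= T ->
    normc (gaussmon k (y%:C - t%:C * s)) <= K * expR (- (l / 4 * y ^+ 2)).
Proof.
exists (expR (k%:R ^+ 2 / (2 * l) + l / 2 * T ^+ 2 * Re s ^+ 2
             + 3 * l / 2 * T ^+ 2 * Im s ^+ 2)); first exact: expR_ge0.
move=> t y tT; set w := y%:C - t%:C * s.
rewrite /gaussmon ComplexField.Normc.normcM normcX normc_cexp.
have nwk : normc w ^+ k <= expR (k%:R * normc w).
  rewrite mulrC expRM_natr lerXn2r// ?nnegrE ?normc_ge0 ?expR_ge0//.
  by rewrite (le_trans _ (expR_ge1Dx _))// lerDr.
apply: (le_trans (ler_wpM2r (expR_ge0 _) nwk)).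
rewrite -!expRD ler_expR.
have amgm : k%:R * normc w <= k%:R ^+ 2 / (2 * l) + l / 2 * normc w ^+ 2.
  rewrite -subr_ge0.
  have -> : k%:R ^+ 2 / (2 * l) + l / 2 * normc w ^+ 2 - k%:R * normc w =
    (k%:R - l * normc w) ^+ 2 / (2 * l) by field; rewrite gt_eqF.
  by rewrite divr_ge0 ?sqr_ge0// mulr_ge0// ltW.
apply: (le_trans (lerD amgm (lexx _))).
have -> : Re (- l%:C * w ^+ 2) = - l * ((Re w) ^+ 2 - (Im w) ^+ 2).
  by rewrite expr2 !complex_partsE /=; ring.
have -> : Re w = y - t * Re s by rewrite /w !complex_partsE /=; ring.
rewrite sqr_normc.
have -> : Re w = y - t * Re s by rewrite /w !complex_partsE /=; ring.
have -> : Im w = - (t * Im s) by rewrite /w !complex_partsE /=; ring.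
have tT2 : t ^+ 2 <= T ^+ 2.
  by rewrite -(real_normK (num_real t)) lerXn2r// nnegrE (le_trans _ tT).
have h1 : l / 2 * t ^+ 2 * Re s ^+ 2 <= l / 2 * T ^+ 2 * Re s ^+ 2.
  by rewrite ler_wpM2r ?sqr_ge0// ler_wpM2l// divr_ge0// ltW.
have h2 : 3 * l / 2 * t ^+ 2 * Im s ^+ 2 <= 3 * l / 2 * T ^+ 2 * Im s ^+ 2.
  by rewrite ler_wpM2r ?sqr_ge0// ler_wpM2l// divr_ge0// mulr_ge0// ltW.
(* The slack in [(y - t Re s)^2 / 2 >= y^2 / 4 - (t Re s)^2 / 2], up to the factor [l]. *)
have h3 : 0 <= l / 4 * (y - 2 * (t * Re s)) ^+ 2.
  by rewrite mulr_ge0 ?sqr_ge0// divr_ge0// ltW.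
by move: (k%:R ^+ 2 / _) => u; nra.
Qed.

Lemma gaussmon_cderive_line k (s : C) x :
  is_cderive x (fun y => gaussmon k (y%:C - s)) (dgaussmon k (x%:C - s)).
Proof.
have : is_cderive x (fun y : R => y%:C - s) 1.
  rewrite (_ : (fun y : R => y%:C - s) = (fun y => - s + y%:C * 1)).
    exact: is_cderive_affine.
  by apply/funext => y; rewrite mulr1 addrC.
by move/(is_cderive_gaussmon k); rewrite mul1r.
Qed.

Lemma gaussmon_cintegrable k (s : C) :
  cintegrable mu (fun y => gaussmon k (y%:C - s)).
Proof.
have [K _ hK] := gaussmon_bound k s 1.
have [m1 m2] := is_cderive_measurable (gaussmon_cderive_line k s).
apply: (@gauss_bounded_cintegrable _ (l / 4) K) => //.
  by rewrite divr_gt0.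
by move=> y; have := hK 1 y; rewrite normr1 mul1r; apply.
Qed.

Lemma dgaussmon_cintegrable k (s : C) :
  cintegrable mu (fun y => dgaussmon k (y%:C - s)).
Proof.
rewrite /dgaussmon; apply: cintegrableD.
  exact/cintegrableZ/gaussmon_cintegrable.
rewrite (_ : (fun y : R => _) = fun y : R =>
  (- (2 * l%:C)) * gaussmon k.+1 (y%:C - s)); last first.
  by apply/funext => y; rewrite mulNr.
exact/cintegrableZ/gaussmon_cintegrable.
Qed.

(** Along a horizontal line the complex derivative of [gaussmon k] is its derivative in the real
    variable [y], so only boundary terms at infinity could contribute. *)
Lemma dgaussmon_cintegral k (s : C) :
  cintegral mu (fun y => dgaussmon k (y%:C - s)) = 0.
Proof.
have [K _ hK] := gaussmon_bound k s 1.
have [i1 i2] := dgaussmon_cintegrable k s.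
have {}hK y : normc (gaussmon k (y%:C - s)) <= K * expR (- (l / 4 * y ^+ 2)).
  by have := hK 1 y; rewrite normr1 mul1r; apply.
have l40 : 0 < l / 4 by rewrite divr_gt0.
have [c1 c2] : continuous (fun y : R => Re (dgaussmon k (y%:C - s))) /\
               continuous (fun y : R => Im (dgaussmon k (y%:C - s))).
  apply: is_cderive_continuous => x; rewrite /dgaussmon.
  apply: is_cderiveD.
    apply: is_cderiveM; first exact: is_cderive_cst.
    exact: gaussmon_cderive_line.
  rewrite (_ : (fun y : R => _) = fun y : R =>
    (- (2 * l%:C)) * gaussmon k.+1 (y%:C - s)); last first.
    by apply/funext => y; rewrite mulNr.
  apply: is_cderiveM; first exact: is_cderive_cst.
  exact: gaussmon_cderive_line.
apply: complexP => /=.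
  apply: (@integral_derive_eq0 _ (fun y => Re (gaussmon k (y%:C - s))) _ _ K
    l40) => // y.
    by have [] := gaussmon_cderive_line k s y.
  by apply: le_trans (hK y); exact: normRe_le.
apply: (@integral_derive_eq0 _ (fun y => Im (gaussmon k (y%:C - s))) _ _ K
  l40) => // y.
  by have [] := gaussmon_cderive_line k s y.
by apply: le_trans (hK y); exact: normIm_le.
Qed.

(* The derivative of [t |-> \int gaussmon k (y - t s) dy] is the integral over
   the line of a derivative, hence vanishes. *)
Lemma gaussmon_shift k (s : C) :
  cintegral mu (fun y => gaussmon k (y%:C - s)) =
  cintegral mu (fun y => gaussmon k y%:C).
Proof.
have curve (y t : R) : is_cderive t (fun t => gaussmon k (y%:C - t%:C * s))
    (- s * dgaussmon k (y%:C - t%:C * s)).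
  apply: is_cderive_gaussmon.
  rewrite (_ : (fun y : R => _) = (fun t => y%:C + t%:C * (- s))).
    exact: is_cderive_affine.
  by apply/funext => t'; rewrite mulrN.
(* Differentiation under the integral at [a] needs one dominating function for all [t] within
   distance 1 of [a]. *)
have bound (a : R) : exists K : R, forall t y : R, `|t| <= `|a| + 1 ->
    normc (- s * dgaussmon k (y%:C - t%:C * s)) <=
      K * expR (- (l / 4 * y ^+ 2)).
  have [K1 _ h1] := gaussmon_bound k.-1 s (`|a| + 1).
  have [K2 _ h2] := gaussmon_bound k.+1 s (`|a| + 1).
  exists (normc s * (normc k%:R * K1 + normc (2 * l%:C) * K2)) => t y ta.
  rewrite mulNr -mulrN ComplexField.Normc.normcM -[leRHS]mulrA.
  rewrite ler_wpM2l ?normc_ge0// /dgaussmon.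
  have := h2 _ y ta; have := h1 _ y ta.
  move: (gaussmon k.-1 _) (gaussmon k.+1 _) => g1 g2 H1 H2.
  rewrite opprB addrC -mulNr (le_trans (le_normcD _ _))// [leRHS]mulrDl.
  rewrite !ComplexField.Normc.normcM !normcN -[_ * K1 * _]mulrA.
  rewrite -[_ * K2 * _]mulrA; apply: lerD.
    by rewrite ler_wpM2l ?normc_ge0.
  by rewrite ler_wpM2l ?mulr_ge0 ?normc_ge0.
(* With zero derivative the integral is constant in [t]; its values at [t = 1] and [t = 0] are the
   two sides. *)
suff cst (pr : C -> R) : pr = Re \/ pr = Im -> forall a : R,
    is_derive a 1 (fun t => \int[mu]_y pr (gaussmon k (y%:C - t%:C * s))) 0.
  have [r1 r2] := (cst Re (or_introl erefl), cst Im (or_intror erefl)).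
  apply: complexP => /=.
    have := @is_derive_0_is_cst _ _ 1 0 r1.
    by rewrite mul1r; under [RHS]eq_Rintegral do rewrite mul0r subr0.
  have := @is_derive_0_is_cst _ _ 1 0 r2.
  by rewrite mul1r; under [RHS]eq_Rintegral do rewrite mul0r subr0.
move=> prE a.
have [K hK] := bound a.
have l40 : 0 < l / 4 by rewrite divr_gt0.
have [ig _] := integral_gauss l40.
have iG := integrableZl measurableT K ig.
pose G y := K * expR (- (l / 4 * y ^+ 2)).
have prle z : `|pr z| <= normc z.
  by case: prE => ->; [exact: normRe_le|exact: normIm_le].
have I1 : forall t : R, `]a - 1, a + 1[ t -> `|t| <= `|a| + 1.
  move=> t /=; rewrite in_itv/= => /andP[h1 h2].
  rewrite -[t](subrK a) addrC (le_trans (ler_normD _ _))// lerD2l ler_norml.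
  by apply/andP; split; lra.
have dpr (t y : R) : is_derive t 1 (fun t => pr (gaussmon k (y%:C - t%:C * s)))
    (pr (- s * dgaussmon k (y%:C - t%:C * s))).
  by have [d1 d2] := curve y t; case: prE => ->.
have Ia : `]a - 1, a + 1[ a by rewrite /= in_itv/=; apply/andP; split; lra.
have intf (t : R) : `]a - 1, a + 1[ t ->
    mu.-integrable setT (EFin \o (fun y => pr (gaussmon k (y%:C - t%:C * s)))).
  move=> _; have [i1 i2] := gaussmon_cintegrable k (t%:C * s).
  by case: prE => ->.
have derf (t y : R) : `]a - 1, a + 1[ t -> setT y ->
    derivable (fun t : R => pr (gaussmon k (y%:C - t%:C * s))) t 1.
  by move=> _ _; have [] := dpr t y.
have G0 y : 0 <= G y.
  have := le_trans (normc_ge0 _) (hK a y _); apply.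
  by rewrite lerDl.
have Gub (t y : R) : `]a - 1, a + 1[ t -> setT y ->
   `|partial1of2 (fun t y : R => pr (gaussmon k (y%:C - t%:C * s))) t y| <= G y.
  move=> /I1 tI _; rewrite partial1of2E.
  have [_ ->] := dpr t y.
  by rewrite (le_trans (prle _))// hK.
have iG' : mu.-integrable setT (EFin \o G) by [].
have d0 := derivable_under_integral measurableT Ia intf derf G0 iG' Gub.
apply: DeriveDef => //.
rewrite -derive1E.
rewrite (differentiation_under_integral measurableT Ia intf derf G0 iG' Gub).
transitivity (\int[mu]_y pr (- s * dgaussmon k (y%:C - a%:C * s))).
  apply: eq_Rintegral => y _; rewrite partial1of2E.
  by have [_ ->] := dpr a y.
have := cintegralZ (- s) (dgaussmon_cintegrable k (a%:C * s)).
rewrite dgaussmon_cintegral mulr0 => /(congr1 pr).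
by case: prE => ->.
Qed.

End ContourShift.

(** * Polynomial functions with a prescribed leading monomial *)

Section LowDegree.
Variable R : realType.
Local Notation C := R[i].
Implicit Types Q : C -> C -> C.

(** The polynomial is presented by a list of terms, so that Gaussian averages can act term by term;
    only the degrees of the terms are recorded. *)
Definition lowdeg N Q := exists2 l : seq (C * (nat * nat)),
  all (fun t => t.2.1 + t.2.2 < N)%N l &
  forall A B, Q A B = \sum_(t <- l) t.1 * (A ^+ t.2.1 * B ^+ t.2.2).

(** The invariant of all the integrations: a leading monomial with coefficient 1 and a remainder
    known only through its degree. *)
Definition leading m n Q :=
  lowdeg (m + n) (fun A B => Q A B - A ^+ m * B ^+ n).

Lemma eq_lowdeg N Q Q' : (forall A B, Q A B = Q' A B) ->
  lowdeg N Q -> lowdeg N Q'.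
Proof. by move=> e [l lN lE]; exists l => // A B; rewrite -e. Qed.

Lemma lowdeg0 N : lowdeg N (fun _ _ => 0).
Proof. by exists [::] => // A B; rewrite big_nil. Qed.

Lemma lowdegD N Q Q' : lowdeg N Q -> lowdeg N Q' ->
  lowdeg N (fun A B => Q A B + Q' A B).
Proof.
move=> [l lN lE] [l' lN' lE']; exists (l ++ l'); first by rewrite all_cat lN.
by move=> A B; rewrite big_cat lE lE'.
Qed.

Lemma lowdeg_mon N (c : C) p q : (p + q < N)%N ->
  lowdeg N (fun A B => c * (A ^+ p * B ^+ q)).
Proof.
move=> pqN; exists [:: (c, (p, q))]; first by rewrite /= pqN.
by move=> A B; rewrite big_seq1.
Qed.

Lemma lowdeg_sum N (I : Type) (r : seq I) (P : pred I) (F : I -> C -> C -> C) :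
  (forall i, P i -> lowdeg N (F i)) ->
  lowdeg N (fun A B => \sum_(i <- r | P i) F i A B).
Proof.
move=> FN; elim: r => [|i r IH].
  by apply: eq_lowdeg (lowdeg0 N) => A B; rewrite big_nil.
have [Pi|nPi] := boolP (P i).
  apply: eq_lowdeg (lowdegD (FN _ Pi) IH) => A B.
  by rewrite big_cons Pi.
by apply: eq_lowdeg IH => A B; rewrite big_cons (negbTE nPi).
Qed.

Lemma leading_mon m n : leading m n (fun A B => A ^+ m * B ^+ n).
Proof. by apply: eq_lowdeg (lowdeg0 _) => A B; rewrite subrr. Qed.

Lemma leadingD m n Q Q' : leading m n Q -> lowdeg (m + n) Q' ->
  leading m n (fun A B => Q A B + Q' A B).
Proof.
move=> lQ lQ'; apply: eq_lowdeg (lowdegD lQ lQ') => A B.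
by rewrite addrAC.
Qed.

(** No term has total degree less than 0, so the remainder is an empty sum. This is what makes the
    Bargmann transform of a coherent state exact. *)
Lemma leading00 Q : leading 0 0 Q -> forall A B, Q A B = 1.
Proof.
move=> [[|t l] lN lE] A B; last by [].
by apply/eqP; rewrite -subr_eq0; have := lE A B; rewrite big_nil mulr1 => ->.
Qed.

End LowDegree.

(** * Averages of polynomials against a Gaussian with complex center *)

Section GaussianAverage.
Variable R : realType.
Local Notation C := R[i].
Local Notation mu := (@lebesgue_measure R).
Variable l : R.
Hypothesis l0 : 0 < l.

Definition gauss_mass : C := (Num.sqrt (pi / l))%:C.

(** Normalized by the total mass, so that the zeroth moment is 1 and averaging keeps leading
    coefficients. *)
Definition gauss_mom k : C :=
  cintegral mu (fun y => gaussmon l k y%:C) / gauss_mass.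

Definition gauss_kernel (s r : C) (y : R) : C :=
  cexp (- l%:C * y%:C ^+ 2 + s * y%:C + r).

(** The critical point of the exponent of [gauss_kernel], in general off the real line. *)
Definition gauss_center (s : C) : C := s / (2 * l%:C).

Definition gauss_weight (s r : C) : C :=
  gauss_mass * cexp (s ^+ 2 / (4 * l%:C) + r).

Let lC0 : l%:C != 0 :> C.
Proof. by rewrite (inj_eq (@complexI R)) gt_eqF. Qed.

Lemma gauss_mass_neq0 : gauss_mass != 0.
Proof.
by rewrite (inj_eq (@complexI R)) gt_eqF// sqrtr_gt0 divr_gt0// pi_gt0.
Qed.

Lemma gauss_mom0 : gauss_mom 0 = 1.
Proof.
rewrite /gauss_mom; apply: (canLR (mulfK gauss_mass_neq0)); rewrite mul1r.
have [_ ie] := integral_gauss l0.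
have e y : gaussmon l 0 y%:C = (expR (- (l * y ^+ 2)))%:C.
  rewrite /gaussmon expr0 mul1r /cexp.
  have -> : - l%:C * y%:C ^+ 2 = (- (l * y ^+ 2))%:C.
    by rewrite rmorphN rmorphM rmorphXn mulNr.
  by rewrite /= cos0 sin0 mulr1.
rewrite (_ : (fun y : R => _) = fun y => (expR (- (l * y ^+ 2)))%:C).
  by apply: complexP; rewrite /= ?ie// /Rintegral integral0.
exact/funext.
Qed.

(** Completing the square turns the exponent into [- l (y - s / (2 l))^2 + s^2 / (4 l) + r]; the
    contour shift then moves the complex center to 0. *)
Lemma gauss_shifted_moment k (s r : C) :
  cintegrable mu (fun y => (y%:C - gauss_center s) ^+ k * gauss_kernel s r y) /\
  cintegral mu (fun y => (y%:C - gauss_center s) ^+ k * gauss_kernel s r y) =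
  gauss_weight s r * gauss_mom k.
Proof.
have E y : (y%:C - gauss_center s) ^+ k * gauss_kernel s r y =
    cexp (s ^+ 2 / (4 * l%:C) + r) * gaussmon l k (y%:C - gauss_center s).
  rewrite /gaussmon [RHS]mulrCA -cexpD /gauss_kernel; congr (_ * cexp _).
  rewrite /gauss_center; field; exact: lC0.
have -> : (fun y : R => (y%:C - gauss_center s) ^+ k * gauss_kernel s r y) =
  (fun y : R => cexp (s ^+ 2 / (4 * l%:C) + r) *
     gaussmon l k (y%:C - gauss_center s)) by apply/funext.
have ig := gaussmon_cintegrable l0 k (gauss_center s).
split; first exact: cintegrableZ.
rewrite cintegralZ// gaussmon_shift// /gauss_weight /gauss_mom.
move: (cintegral _ _) (cexp _) gauss_mass gauss_mass_neq0 => I e m m0.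
by field.
Qed.

Variables b d : C.

(* [Q'] must not depend on [a], [c], [s], [r]: the average of [Q] only sees the
   complex center, where the affine forms are evaluated. *)
Definition averages (Q Q' : C -> C -> C) := forall a c s r : C,
  let f := fun y : R => Q (a + b * y%:C) (c + d * y%:C) * gauss_kernel s r y in
  cintegrable mu f /\
  cintegral mu f = gauss_weight s r *
    Q' (a + b * gauss_center s) (c + d * gauss_center s).

Lemma averages0 : averages (fun _ _ => 0) (fun _ _ => 0).
Proof.
move=> a c s r /=; rewrite (_ : (fun y : R => _) = fun=> 0).
  by rewrite cintegral0 mulr0; split => //; exact: cintegrable0.
by apply/funext => y; rewrite mul0r.
Qed.

Lemma averagesD P P' Q Q' : averages P P' -> averages Q Q' ->
  averages (fun A B => P A B + Q A B) (fun A B => P' A B + Q' A B).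
Proof.
move=> hP hQ a c s r /=.
rewrite (_ : (fun y : R => _) = fun y =>
  P (a + b * y%:C) (c + d * y%:C) * gauss_kernel s r y +
  Q (a + b * y%:C) (c + d * y%:C) * gauss_kernel s r y); last first.
  by apply/funext => y; rewrite mulrDl.
have [p1 p2] := hP a c s r; have [q1 q2] := hQ a c s r.
by rewrite mulrDr -p2 -q2; split; [exact: cintegrableD|exact: cintegralD].
Qed.

Lemma averagesZ (k : C) Q Q' : averages Q Q' ->
  averages (fun A B => k * Q A B) (fun A B => k * Q' A B).
Proof.
move=> hQ a c s r /=.
rewrite (_ : (fun y : R => _) = fun y =>
  k * (Q (a + b * y%:C) (c + d * y%:C) * gauss_kernel s r y)); last first.
  by apply/funext => y; rewrite mulrA.
have [q1 q2] := hQ a c s r.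
rewrite mulrCA -q2; split; [exact: cintegrableZ|exact: cintegralZ].
Qed.

(** The binomial expansion of [(A + b v)^p (B + d v)^q], where [v] is the displacement from the
    center and each [v^k] is replaced by its moment. *)
Definition avg_mon p q (A B : C) : C := \sum_(i < p.+1) \sum_(j < q.+1)
  ('C(p, i)%:R * 'C(q, j)%:R * b ^+ i * d ^+ j * gauss_mom (i + j)) *
  (A ^+ (p - i) * B ^+ (q - j)).

Lemma averages_mon p q : averages (fun A B => A ^+ p * B ^+ q) (avg_mon p q).
Proof.
move=> a c s r /=.
set A := a + b * gauss_center s; set B := c + d * gauss_center s.
pose t i j (y : R) : C := 
  ('C(p, i)%:R * 'C(q, j)%:R * b ^+ i * d ^+ j * (A ^+ (p - i) * B ^+ (q - j)))
  * ((y%:C - gauss_center s) ^+ (i + j) * gauss_kernel s r y).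
rewrite (_ : (fun y : R => _) =
    fun y => \sum_(i < p.+1) \sum_(j < q.+1) t i j y); last first.
  apply/funext => y.
  have -> : a + b * y%:C = A + b * (y%:C - gauss_center s) by rewrite /A; ring.
  have -> : c + d * y%:C = B + d * (y%:C - gauss_center s) by rewrite /B; ring.
  rewrite !exprDn mulr_suml mulr_suml; apply: eq_bigr => i _.
  rewrite mulr_sumr mulr_suml; apply: eq_bigr => j _.
  rewrite /t !exprMn exprD -[X in X * _ * _]mulr_natl -[X in _ * X * _]mulr_natl.
  move: (A ^+ _) (B ^+ _) => u v; ring.
have it i j : cintegrable mu (t i j).
  by apply: cintegrableZ; have [] := gauss_shifted_moment (i + j) s r.
split; first by do 2 apply: cintegrable_sum => ? _.
rewrite cintegral_sum; last by move=> i _; apply: cintegrable_sum => ? _.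
rewrite /avg_mon mulr_sumr; apply: eq_bigr => i _.
rewrite cintegral_sum// mulr_sumr; apply: eq_bigr => j _.
have [i1 i2] := gauss_shifted_moment (i + j) s r.
by rewrite cintegralZ// i2; move: (A ^+ _) (B ^+ _) => u v; ring.
Qed.

Lemma avg_mon_lowdeg N p q : (p + q < N)%N -> lowdeg N (avg_mon p q).
Proof.
move=> pqN; do 2 apply: lowdeg_sum => ? _.
by apply: lowdeg_mon; rewrite (leq_ltn_trans _ pqN)// leq_add// leq_subr.
Qed.

(** The term [i = j = 0] is the monomial itself because [gauss_mom 0 = 1]; every other term trades
    at least one factor [A] or [B] for a moment. *)
Lemma avg_mon_leading p q : leading p q (avg_mon p q).
Proof.
pose t i j (A B : C) :=
  ('C(p, i)%:R * 'C(q, j)%:R * b ^+ i * d ^+ j * gauss_mom (i + j)) *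
  (A ^+ (p - i) * B ^+ (q - j)).
have tE A B : avg_mon p q A B - A ^+ p * B ^+ q =
    \sum_(j < q) t 0 j.+1 A B + \sum_(i < p) \sum_(j < q.+1) t i.+1 j A B.
  have t00 : t 0%N 0%N A B = A ^+ p * B ^+ q.
    by rewrite /t !bin0 !expr0 !mul1r gauss_mom0 mul1r !subn0.
  rewrite -t00 /avg_mon big_ord_recl big_ord_recl.
  by rewrite addrC -!addrA addKr.
apply: (eq_lowdeg (fun A B => esym (tE A B))); apply: lowdegD.
  apply: lowdeg_sum => j _; apply: lowdeg_mon.
  by rewrite subn0 ltn_add2l ltn_subrL (leq_ltn_trans _ (ltn_ord j)).
apply: lowdeg_sum => i _; apply: lowdeg_sum => j _; apply: lowdeg_mon.
rewrite -addSn leq_add ?leq_subr// ltn_subrL.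
by rewrite (leq_ltn_trans _ (ltn_ord i)).
Qed.

Lemma averages_lowdeg N Q : lowdeg N Q ->
  exists2 Q', lowdeg N Q' & averages Q Q'.
Proof.
move=> [r rN QE].
have -> : Q = (fun A B => \sum_(t <- r) t.1 * (A ^+ t.2.1 * B ^+ t.2.2)).
  by apply/funext => A; apply/funext.
elim: r rN {Q QE} => [_|t r IH /= /andP[tN /IH[Q' Q'N Q'E]]].
  exists (fun _ _ => 0); first exact: lowdeg0.
  rewrite (_ : (fun A B => _) = (fun _ _ => 0)); first exact: averages0.
  by apply/funext => A; apply/funext => B; rewrite big_nil.
exists (fun A B => t.1 * avg_mon t.2.1 t.2.2 A B + Q' A B).
  apply: lowdegD => //.
  have [s sN sE] := avg_mon_lowdeg tN.
  exists [seq (t.1 * u.1, u.2) | u <- s]; first by rewrite all_map.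
  move=> A B; rewrite big_map sE mulr_sumr; apply: eq_bigr => u _ /=.
  by rewrite mulrA.
rewrite (_ : (fun A B => _) = (fun A B => t.1 * (A ^+ t.2.1 * B ^+ t.2.2) +
  \sum_(t <- r) t.1 * (A ^+ t.2.1 * B ^+ t.2.2))).
  by apply: averagesD => //; apply: averagesZ; exact: averages_mon.
by apply/funext => A; apply/funext => B; rewrite big_cons.
Qed.

(** One Gaussian integration evaluates at the center and preserves the leading monomial. The output
    is again an admissible input, so nested integrals are handled by iteration. *)
Lemma averages_leading m n Q : leading m n Q ->
  exists2 Q', leading m n Q' & averages Q Q'.
Proof.
move=> /averages_lowdeg[Q' Q'N Q'E].
exists (fun A B => avg_mon m n A B + Q' A B).
  by apply: leadingD => //; exact: avg_mon_leading.
have := averagesD (averages_mon m n) Q'E.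
rewrite (_ : (fun A B => _) = Q)//.
by apply/funext => A; apply/funext => B; rewrite addrC subrK.
Qed.

End GaussianAverage.

(** * Product measures *)

Section ProductIntegral.
Local Open Scope ereal_scope.
Context d1 d2 (T1 : measurableType d1) (T2 : measurableType d2) (R : realType).
Variable m1 : {sigma_finite_measure set T1 -> \bar R}.
Variable m2 : {sigma_finite_measure set T2 -> \bar R}.

Lemma integrable_prod (f : T1 -> R) (g : T2 -> R) :
  m1.-integrable setT (EFin \o f) -> m2.-integrable setT (EFin \o g) ->
  (m1 \x m2).-integrable setT (fun p => (f p.1 * g p.2)%:E).
Proof.
move=> fi gi.
have mf : measurable_fun setT f by apply/measurable_EFinP; case/integrableP: fi.
have mg : measurable_fun setT g by apply/measurable_EFinP; case/integrableP: gi.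
apply/integrable12ltyP.
  apply/measurable_EFinP/measurable_funM; exact: measurableT_comp.
have gi' : \int[m2]_y `|(g y)%:E| = (\int[m2]_y `|g y|)%:E.
  rewrite /Rintegral fineK//.
  exact: (integrable_fin_num measurableT (integrable_abse gi)).
have E x : \int[m2]_y `|(f x * g y)%:E| = (`|f x| * (\int[m2]_y `|g y|))%:E.
  under eq_integral do rewrite EFinM abseM.
  rewrite ge0_integralZl//; last exact/measurable_EFinP/measurableT_comp.
  by rewrite gi'.
under eq_integral do rewrite E.
have : m1.-integrable setT (fun x => (`|f x| * (\int[m2]_y `|g y|))%:E).
  under eq_fun do rewrite EFinM.
  by apply: integrableZr => //; exact: integrable_norm.
move=> /integrableP[_]; apply: le_lt_trans.
rewrite le_eqVlt; apply/orP; left; apply/eqP.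
apply: eq_integral => x _; rewrite gee0_abs// lee_fin mulr_ge0//.
by rewrite Rintegral_ge0.
Qed.

Lemma Rintegral_prod (f : T1 -> R) (g : T2 -> R) :
  m1.-integrable setT (EFin \o f) -> m2.-integrable setT (EFin \o g) ->
  (\int[m1 \x m2]_p (f p.1 * g p.2) = (\int[m1]_x f x) * (\int[m2]_y g y))%R.
Proof.
move=> fi gi.
rewrite /Rintegral -integral12_prod_meas1; last exact: integrable_prod.
rewrite /fubini_F /=.
have E x : \int[m2]_y (f x * g y)%:E = (f x * (\int[m2]_y g y))%:E.
  under eq_integral do rewrite EFinM.
  rewrite integralZl// EFinM; congr (_ * _).
  by rewrite /Rintegral fineK// integrable_fin_num.
under eq_integral do rewrite E.
exact: RintegralZr.
Qed.

Lemma cintegrable_prod (f : T1 -> R[i]) (g : T2 -> R[i]) :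
  cintegrable m1 f -> cintegrable m2 g ->
  cintegrable (m1 \x m2) (fun p => f p.1 * g p.2)%R.
Proof.
move=> [f1 f2] [g1 g2]; split.
  rewrite (_ : (fun p : T1 * T2 => (complex.Re (f p.1 * g p.2)%R)%:E) = (fun p =>
      (complex.Re (f p.1) * complex.Re (g p.2))%:E -
      (complex.Im (f p.1) * complex.Im (g p.2))%:E)); last first.
    by apply/funext => p; rewrite (ReM (f p.1)) EFinB.
  exact: (integrableB measurableT (integrable_prod f1 g1)
    (integrable_prod f2 g2)).
rewrite (_ : (fun p : T1 * T2 => (complex.Im (f p.1 * g p.2)%R)%:E) = (fun p =>
    (complex.Re (f p.1) * complex.Im (g p.2))%:E +
    (complex.Im (f p.1) * complex.Re (g p.2))%:E)); last first.
  by apply/funext => p; rewrite (ImM (f p.1)) EFinD.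
exact: (integrableD measurableT (integrable_prod f1 g2)
  (integrable_prod f2 g1)).
Qed.

Lemma cintegral_prod (f : T1 -> R[i]) (g : T2 -> R[i]) :
  cintegrable m1 f -> cintegrable m2 g ->
  (cintegral (m1 \x m2)%E (fun p => f p.1 * g p.2) =
   cintegral m1 f * cintegral m2 g)%R.
Proof.
move=> [f1 f2] [g1 g2]; apply: complexP; rewrite complex_partsE /=.
  under [LHS]eq_Rintegral => p _ do rewrite (ReM (f p.1)).
  rewrite (RintegralB measurableT (integrable_prod f1 g1)
    (integrable_prod f2 g2)).
  by rewrite (Rintegral_prod f1 g1) (Rintegral_prod f2 g2).
under [LHS]eq_Rintegral => p _ do rewrite (ImM (f p.1)).
rewrite (RintegralD measurableT (integrable_prod f1 g2)
  (integrable_prod f2 g1)).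
by rewrite (Rintegral_prod f1 g2) (Rintegral_prod f2 g1).
Qed.

(** Since every section is integrable, each inner integral is finite and the real-valued integrals
    agree pointwise with the extended ones. *)
Lemma cintegral_fubini (F : T1 * T2 -> R[i]) :
  cintegrable (m1 \x m2) F ->
  (forall x, cintegrable m2 (fun y => F (x, y))) ->
  cintegral (m1 \x m2) F =
  cintegral m1 (fun x => cintegral m2 (fun y => F (x, y))).
Proof.
have fub (f : T1 * T2 -> R) : (m1 \x m2).-integrable setT (EFin \o f) ->
    (forall x, m2.-integrable setT (fun y => (f (x, y))%:E)) ->
    (\int[m1 \x m2]_p f p = \int[m1]_x \int[m2]_y f (x, y))%R.
  move=> fi fx; rewrite /Rintegral -integral12_prod_meas1//; congr fine.
  apply: eq_integral => x _ /=.
  by rewrite fineK//; exact: integrable_fin_num.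
move=> [f1 f2] fx; apply: complexP; rewrite /= fub// => x.
  by have [] := fx x.
by have [] := fx x.
Qed.

End ProductIntegral.

Section PowerIntegral.
Local Open Scope ereal_scope.
Context dp (T : measurableType dp) (R : realType).
Variable mu : {sigma_finite_measure set T -> \bar R}.

Lemma cintegral_power_step n
  (m : {sigma_finite_measure set (n.-tuple T) -> \bar R})
  (F : n.+1.-tuple T -> R[i]) :
  cintegrable (mu \x m) (fun p => F (tuple_cons p)) ->
  measurable_fun setT (fun t => complex.Re (F t)) ->
  measurable_fun setT (fun t => complex.Im (F t)) ->
  cintegrable (power_step mu m) F /\
  cintegral (power_step mu m) F = cintegral (mu \x m) (fun p => F (tuple_cons p)).
Proof.
move=> [i1 i2] m1 m2.
have mcons := @measurable_tuple_cons _ T n.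
split.
  split.
    apply: (@integrable_pushforward _ _ _ _ _ (@tuple_cons _ T n) mcons
      (mu \x m) setT (fun t => (complex.Re (F t))%:E)) => //.
    exact/measurable_EFinP.
  apply: (@integrable_pushforward _ _ _ _ _ (@tuple_cons _ T n) mcons
      (mu \x m) setT (fun t => (complex.Im (F t))%:E)) => //.
  exact/measurable_EFinP.
apply: complexP; rewrite /= /Rintegral; congr fine.
  rewrite (@integral_pushforward _ _ _ _ _ (@tuple_cons _ T n) mcons
      (mu \x m) setT (fun t => (complex.Re (F t))%:E)) //.
  exact/measurable_EFinP.
rewrite (@integral_pushforward _ _ _ _ _ (@tuple_cons _ T n) mcons
      (mu \x m) setT (fun t => (complex.Im (F t))%:E)) //.
exact/measurable_EFinP.
Qed.

Definition cmeasurable d' (T' : measurableType d') (f : T' -> R[i]) :=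
  measurable_fun setT (fun t => complex.Re (f t)) /\
  measurable_fun setT (fun t => complex.Im (f t)).

Lemma cmeasurableM d' (T' : measurableType d') (f g : T' -> R[i]) :
  cmeasurable f -> cmeasurable g -> cmeasurable (fun t => f t * g t)%R.
Proof.
move=> [f1 f2] [g1 g2]; split.
  rewrite (_ : (fun t => complex.Re (f t * g t)%R) = (fun t =>
    complex.Re (f t) * complex.Re (g t) -
    complex.Im (f t) * complex.Im (g t))%R).
    by apply: measurable_funB; exact: measurable_funM.
  by apply/funext => t; rewrite ReM.
rewrite (_ : (fun t => complex.Im (f t * g t)%R) = (fun t =>
  complex.Re (f t) * complex.Im (g t) +
  complex.Im (f t) * complex.Re (g t))%R).
  by apply: measurable_funD; exact: measurable_funM.
by apply/funext => t; rewrite ImM.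
Qed.

Lemma cmeasurable_prod d' (T' : measurableType d') (I : Type) (r : seq I)
  (f : I -> T' -> R[i]) : (forall i, cmeasurable (f i)) ->
  cmeasurable (fun t => \prod_(i <- r) f i t)%R.
Proof.
move=> fm; elim: r => [|i r IH].
  rewrite (_ : (fun t : T' => _) = cst 1%R); first by split; exact: measurable_cst.
  by apply/funext => t; rewrite big_nil.
rewrite (_ : (fun t : T' => _) =
    (fun t => f i t * \prod_(i <- r) f i t)%R); first exact: cmeasurableM.
by apply/funext => t; rewrite big_cons.
Qed.

Lemma cintegrable_cmeasurable d' (T' : measurableType d')
    (m : {measure set T' -> \bar R}) (f : T' -> R[i]) :
  cintegrable m f -> cmeasurable f.
Proof.
by move=> [/integrableP[? _] /integrableP[? _]]; split;
  exact/measurable_EFinP.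
Qed.

(** Induction on [n], splitting off the first coordinate; at [n = 0] the measure is the unit mass at
    the empty tuple and both products are empty. *)
Lemma cintegral_power n (h : 'I_n -> T -> R[i]) :
  (forall j, cintegrable mu (h j)) ->
  cintegrable (power_measure mu n) (fun t => \prod_j h j (tnth t j))%R /\
  (cintegral (power_measure mu n) (fun t => \prod_j h j (tnth t j)) =
   \prod_j cintegral mu (h j))%R.
Proof.
elim: n h => [|n IH] h hi.
  rewrite big_ord0 (_ : (fun t : 0.-tuple T => _) = cst 1%R); last first.
    by apply/funext => t; rewrite big_ord0.
  split.
    by split; apply: finite_measure_integrable_cst.
  have d1 : (\d_ [tuple] : set (0.-tuple T) -> \bar R) setT = 1 by exact: diracT.
  apply: complexP; rewrite /= Rintegral_cst// ?mul0r//.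
  by rewrite [X in fine X]d1 mulr1.
have [h1 h2] := IH (fun j => h (lift ord0 j)) (fun j => hi (lift ord0 j)).
have E p : (\prod_j h j (tnth (tuple_cons p) j) =
    h ord0 p.1 * \prod_j h (lift ord0 j) (tnth p.2 j))%R.
  rewrite big_ord_recl; congr (_ * _)%R; apply: eq_bigr => j _.
  by rewrite (tnth_nth p.1) /= -tnth_nth.
have [m1 m2] : cmeasurable (fun t : n.+1.-tuple T =>
    \prod_j h j (tnth t j))%R.
  apply: cmeasurable_prod => j.
  have [a1 a2] := cintegrable_cmeasurable (hi j).
  have mt := @measurable_tnth _ T _ j.
  by split; [exact: (measurableT_comp a1 mt)|exact: (measurableT_comp a2 mt)].
have hE : (fun p => \prod_j h j (tnth (@tuple_cons _ T n p) j))%R =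
    (fun p => h ord0 p.1 * \prod_j h (lift ord0 j) (tnth p.2 j))%R.
  exact/funext.
have := @cintegral_power_step n (power_measure mu n) _ _ m1 m2.
rewrite hE => -[|i1 i2]; first exact: (cintegrable_prod (hi ord0) h1).
by split => //; rewrite i2 (cintegral_prod (hi ord0) h1) h2 big_ord_recl.
Qed.

End PowerIntegral.

(** * Weyl, Bargmann and Wick integrals on coherent states *)

Section OneDimension.
Variable R : realType.
Local Notation C := R[i].
Local Notation mu := (@lebesgue_measure R).
Local Notation i := ('i%C : C).

Definition sqrt2 : C := (Num.sqrt 2)%:C.

Lemma sqrt2_sqr : sqrt2 ^+ 2 = 2.
Proof. by rewrite -rmorphXn /= sqr_sqrtr// rmorph_nat. Qed.

Lemma sqrt2_neq0 : sqrt2 != 0.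
Proof.
apply/eqP => s0; have := sqrt2_sqr.
by rewrite s0 expr0n => /esym/eqP; rewrite pnatr_eq0.
Qed.

Let half : (2^-1 : R)%:C = 2^-1 :> C.
Proof. by rewrite fmorphV rmorph_nat. Qed.

(* The one-dimensional factors of the coherent state with (complex) center [u]
   and of the Bargmann kernel, up to powers of [pi]. *)
Definition coherent1 (u : C) (y : R) : C :=
  cexp (- 2^-1 * y%:C ^+ 2 + sqrt2 * u * y%:C - 2^-1 * u ^+ 2).

Definition bargmann_kernel1 (z : C) (y : R) : C :=
  cexp (- 2^-1 * (z ^+ 2 + y%:C ^+ 2) + sqrt2 * (z * y%:C)).

(** The power of [xi] is left out: it is constant in [y] and enters at the outer integration. *)
Definition weyl_integrand1 m (u : C) (x xi y : R) : C :=
  (2^-1 * (x%:C + y%:C)) ^+ m * coherent1 u y *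
  cexp (i * ((x%:C - y%:C) * xi%:C)).

(** Here [w = x + i y]: one coordinate of the Wick integrand for [e^(w u)], without the powers of
    [z], which are constant under the integral. *)
Definition wick_integrand1 n (u z : C) (x y : R) : C :=
  (x%:C - i * y%:C) ^+ n *
  cexp ((x%:C + i * y%:C) * u +
        (z - (x%:C + i * y%:C)) * (x%:C - i * y%:C)).

(** The inner integration involves a single affine form, the second slot being filled with 0; the
    outer integrand then brings in a second form to the power [n]. *)
Lemma leading_mulr m n (Q : C -> C -> C) : leading m 0 Q ->
  leading m n (fun A B => Q A 0 * B ^+ n).
Proof.
move=> [l lN lE].
exists [seq (t.1 * 0 ^+ t.2.2, (t.2.1, n)) | t <- l].
  rewrite all_map; apply/allP => t tl /=.
  have := allP lN _ tl; rewrite addn0 => tN.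
  by rewrite ltn_add2r (leq_ltn_trans _ tN)// leq_addr.
move=> A B; rewrite -mulrBl big_map /=.
have := lE A 0; rewrite expr0 mulr1 => ->; rewrite mulr_suml.
by apply: eq_bigr => t _; rewrite -!mulrA [0 ^+ _ * _]mulrCA.
Qed.

(** The order of integration matters: the coherent state gives decay in [y], and the result of that
    integral decays in [xi]. The [y]-integral has center [sqrt2 u - i xi], where [(x + y) / 2]
    becomes [(x + sqrt2 u - i xi) / 2]. The [xi]-integral has center [i (x - sqrt2 u)], where this
    becomes [x]. Each integral has mass [sqrt (2 pi)], and their product compensates the factor
    [1 / (2 pi)] of the quantization. *)
Lemma weyl1 m n : exists2 W : C -> C -> C, leading m n W &
  forall (x : R) (u : C),
    let inner xi := cintegral mu (weyl_integrand1 m u x xi) in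
    [/\ forall xi, cintegrable mu (weyl_integrand1 m u x xi),
        cintegrable mu (fun xi => xi%:C ^+ n * inner xi) &
        cintegral mu (fun xi => xi%:C ^+ n * inner xi) =
          (2 * pi)%:C * (coherent1 u x * W x%:C (i * (x%:C - sqrt2 * u)))].
Proof.
have h0 : 0 < 2^-1 :> R by rewrite invr_gt0.
have [Q1 lQ1 aQ1] := averages_leading h0 (2^-1) 0 (leading_mon R m 0).
(* The slope in [xi] of [(x + y) / 2] at the center of the [y]-integral. *)
have [W lW aW] := averages_leading h0 (- (i / 2)) 1 (leading_mulr n lQ1).
exists W => // x u inner.
have s2 := sqrt2_sqr; have i2 := sqr_i R.
pose s (xi : R) : C := sqrt2 * u - i * xi%:C.
pose r (xi : R) : C := - 2^-1 * u ^+ 2 + i * x%:C * xi%:C.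
have E1 xi : weyl_integrand1 m u x xi = fun y : R =>
    ((2^-1 * x%:C + 2^-1 * y%:C) ^+ m * (0 + 0 * y%:C) ^+ 0) *
    gauss_kernel 2^-1 (s xi) (r xi) y.
  apply/funext => y; rewrite /weyl_integrand1 expr0 mulr1 mulrDr -mulrA.
  rewrite -cexpD /gauss_kernel half; congr (_ * cexp _).
  by rewrite /s /r; ring.
have i1 xi : cintegrable mu (weyl_integrand1 m u x xi).
  by rewrite E1; have [] := aQ1 (2^-1 * x%:C) 0 (s xi) (r xi).
pose s' : C := i * (x%:C - sqrt2 * u).
pose r' : C := 2^-1 * u ^+ 2.
have E2 xi : inner xi = gauss_mass (2^-1 : R) *
    (Q1 (2^-1 * (x%:C + sqrt2 * u) + - (i / 2) * xi%:C) 0 *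
     gauss_kernel 2^-1 s' r' xi).
  rewrite /inner E1; have [_ ->] := aQ1 (2^-1 * x%:C) 0 (s xi) (r xi).
  rewrite /gauss_weight -[LHS]mulrA; congr (_ * _); rewrite [LHS]mulrC; congr (_ * _).
    congr (Q1 _ _); last by rewrite mul0r addr0.
    by rewrite /gauss_center half /s; field.
  rewrite /gauss_kernel half; congr cexp; rewrite /s /r /s' /r'.
  by field: s2 i2.
have E3 : (fun xi : R => xi%:C ^+ n * inner xi) = (fun xi : R =>
    gauss_mass (2^-1 : R) *
    (Q1 (2^-1 * (x%:C + sqrt2 * u) + - (i / 2) * xi%:C) 0 *
     (0 + 1 * xi%:C) ^+ n * gauss_kernel 2^-1 s' r' xi)).
  apply/funext => xi; by rewrite E2 add0r mul1r; ring.
have [j1 j2] := aW (2^-1 * (x%:C + sqrt2 * u)) 0 s' r'.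
split => //; first by rewrite E3; exact: cintegrableZ.
rewrite E3 cintegralZ// j2 /gauss_weight [LHS]mulrA [X in X * _ = _]mulrA.
rewrite [RHS]mulrA; congr (_ * _ * W _ _).
- rewrite /gauss_mass -rmorphM -expr2 sqr_sqrtr; last first.
    by rewrite divr_ge0 ?pi_ge0// invr_ge0.
  by rewrite invrK mulrC.
- rewrite /coherent1 half; congr cexp; rewrite /s' /r'.
  by field: s2 i2.
- by rewrite /gauss_center half /s'; field: i2.
- by rewrite /gauss_center half /s'; field.
Qed.

(** The exponents of the kernel and of the coherent state add up to [- x^2 + sqrt2 (z + u) x - (z^2
    + u^2) / 2]. The center is [(z + u) / sqrt2]; there [i (x - sqrt2 u)] equals [i (z - u) / sqrt2]
    and the exponent equals [z u]. *)
Lemma bargmann1 m n (W : C -> C -> C) : leading m n W ->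
  exists2 V : C -> C -> C, leading m n V &
  forall (z u : C), let f := fun x => bargmann_kernel1 z x *
      (coherent1 u x * W x%:C (i * (x%:C - sqrt2 * u))) in
    cintegrable mu f /\
    cintegral mu f = (Num.sqrt pi)%:C * cexp (z * u) *
      V ((z + u) / sqrt2) (i * (z - u) / sqrt2).
Proof.
move=> lW; have [V lV aV] := averages_leading (@ltr01 R) 1 i lW.
exists V => // z u /=.
have s2 := sqrt2_sqr; have i2 := sqr_i R; have s0 := sqrt2_neq0.
pose s := sqrt2 * (z + u); pose r := - 2^-1 * (z ^+ 2 + u ^+ 2).
rewrite (_ : (fun x : R => _) = fun x : R =>
    W (0 + 1 * x%:C) (- (i * sqrt2 * u) + i * x%:C) * gauss_kernel 1 s r x).
  have [j1 ->] := aV 0 (- (i * sqrt2 * u)) s r; split => //.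
  rewrite /gauss_weight /gauss_mass divr1; congr (_ * cexp _ * V _ _).
  - by rewrite rmorph1 /s /r; field: s2.
  - by rewrite /gauss_center rmorph1 /s; field: s2.
  - by rewrite /gauss_center rmorph1 /s; field: s2.
apply/funext => x; rewrite mulrCA mulrA mulrC; congr (_ * _).
  by congr (W _ _); ring.
by rewrite -cexpD /gauss_kernel rmorph1; congr cexp; rewrite /s /r; field.
Qed.

(** The [y]-integral has center [i (u - z) / 2], where [x - i y] becomes [x + (u - z) / 2]; the
    [x]-integral has center [(u + z) / 2], where this becomes [u]. The exponent equals [z u] there,
    and the two masses [sqrt pi] multiply to [pi]. *)
Lemma wick1 n : exists2 V : C -> C -> C, leading n 0 V &
  forall (z u : C), let inner x := cintegral mu (wick_integrand1 n u z x) in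
    [/\ forall x, cintegrable mu (wick_integrand1 n u z x),
        cintegrable mu inner &
        cintegral mu inner = pi%:C * cexp (z * u) * V u 0].
Proof.
have [Q1 lQ1 aQ1] := averages_leading (@ltr01 R) (- i) 0 (leading_mon R n 0).
have [V lV aV] := averages_leading (@ltr01 R) 1 0 (leading_mulr 0 lQ1).
exists V => // z u inner.
have i2 := sqr_i R.
pose s := i * (u - z); pose r (x : R) : C := x%:C * (u + z) - x%:C ^+ 2.
have E1 x : wick_integrand1 n u z x = fun y : R =>
    ((x%:C + (- i) * y%:C) ^+ n * (0 + 0 * y%:C) ^+ 0) *
    gauss_kernel 1 s (r x) y.
  apply/funext => y; rewrite /wick_integrand1 expr0 mulr1 mulNr.
  rewrite /gauss_kernel rmorph1; congr (_ * cexp _).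
  by rewrite /s /r; ring: i2.
have i1 x : cintegrable mu (wick_integrand1 n u z x).
  by rewrite E1; have [] := aQ1 x%:C 0 s (r x).
pose s' := u + z; pose r' := - (4^-1 * (u - z) ^+ 2).
have E2 : inner = fun x : R => gauss_mass (1 : R) *
    (Q1 (2^-1 * (u - z) + 1 * x%:C) 0 * (0 + 0 * x%:C) ^+ 0 *
     gauss_kernel 1 s' r' x).
  apply/funext => x; rewrite /inner E1; have [_ ->] := aQ1 x%:C 0 s (r x).
  rewrite /gauss_weight expr0 mulr1 -[LHS]mulrA; congr (_ * _).
  rewrite [LHS]mulrC; congr (_ * _).
    congr (Q1 _ _); last by rewrite mul0r addr0.
    by rewrite /gauss_center rmorph1 /s; field: i2.
  rewrite /gauss_kernel rmorph1; congr cexp; rewrite /s /r /s' /r'.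
  by field: i2.
have [j1 j2] := aV (2^-1 * (u - z)) 0 s' r'.
split => //; first by rewrite E2; exact: cintegrableZ.
rewrite E2 cintegralZ// j2 /gauss_weight mulrA; congr (_ * V _ _).
- rewrite mulrA; congr (_ * cexp _).
    by rewrite /gauss_mass divr1 -rmorphM -expr2 sqr_sqrtr// pi_ge0.
  by rewrite rmorph1 /s' /r'; field.
- by rewrite /gauss_center rmorph1 /s'; field.
- by rewrite mul0r addr0.
Qed.

End OneDimension.

(** * Factorization of d-dimensional integrals over the coordinates *)

Section Assembly.
Variables (R : realType) (d : nat).
Local Notation C := R[i].
Local Notation mu := (@lebesgue_measure R).
Local Notation i := ('i%C : C).

Lemma cintegral_lebesgue_tuple (I : finType) (P : pred I) (k : I -> C)
  (h : I -> 'I_d -> R -> C) : (forall p j, cintegrable mu (h p j)) ->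
  let f := fun t : d.-tuple (measurableTypeR R) =>
    \sum_(p | P p) k p * \prod_j h p j (rvec t 0 j) in
  cintegrable (@lebesgue_tuple R d) f /\
  cintegral (@lebesgue_tuple R d) f =
    \sum_(p | P p) k p * \prod_j cintegral mu (h p j).
Proof.
move=> hi f.
have fE : f = fun t => \sum_(p | P p) k p * \prod_j h p j (tnth t j).
  apply/funext => t; apply: eq_bigr => p _; congr (_ * _).
  by apply: eq_bigr => j _; rewrite mxE.
have pw p := cintegral_power (hi p).
rewrite fE; split.
  by apply: cintegrable_sum => p _; apply: cintegrableZ; have [] := pw p.
rewrite cintegral_sum; last first.
  by move=> p _; apply: cintegrableZ; have [] := pw p.
by apply: eq_bigr => p _; have [p1 p2] := pw p; rewrite cintegralZ// p2.
Qed.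

Lemma integralR_sum_prod (I : finType) (P : pred I) (k : I -> C)
  (h : I -> 'I_d -> R -> C) (F : 'rV[R]_d -> C) :
  (forall p j, cintegrable mu (h p j)) ->
  (forall y, F y = \sum_(p | P p) k p * \prod_j h p j (y 0 j)) ->
  integralR F = \sum_(p | P p) k p * \prod_j cintegral mu (h p j).
Proof.
move=> hi FE; have [_ <-] := cintegral_lebesgue_tuple P k hi.
by congr cintegral; apply/funext => t; rewrite FE.
Qed.

Lemma sum_le_pair N (c : mindex d N -> mindex d N -> C) (u v : 'rV[C]_d) :
  sum_le c u v = \sum_(p : mindex d N * mindex d N |
      (mlen p.1 + mlen p.2 <= N)%N)
    c p.1 p.2 * \prod_j (u 0 j ^+ p.1 j * v 0 j ^+ p.2 j).
Proof.
rewrite /sum_le pair_big_dep /=; apply: eq_bigr => p _.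
by rewrite -mulrA /mpow -big_split.
Qed.

Lemma sum_top_pair N (c : mindex d N -> mindex d N -> C) (u v : 'rV[C]_d) :
  sum_top c u v = \sum_(p : mindex d N * mindex d N |
      (mlen p.1 + mlen p.2 == N)%N)
    c p.1 p.2 * \prod_j (u 0 j ^+ p.1 j * v 0 j ^+ p.2 j).
Proof.
rewrite /sum_top pair_big_dep /=; apply: eq_bigr => p _.
by rewrite -mulrA /mpow -big_split.
Qed.

Definition coherent_cst : C := (pi `^ (- (d%:R / 4)))%:C.

(** One factor [pi^(-d/4)] belongs to the Bargmann transform, the other normalizes the coherent
    state; [sqrt pi] is the mass of each coordinate integral. *)
Lemma coherent_cstK :
  coherent_cst * coherent_cst * \prod_(j < d) (Num.sqrt pi)%:C = 1.
Proof.
rewrite /coherent_cst prodr_const card_ord -rmorphXn -!rmorphM /=.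
rewrite -powRD; last by rewrite (gt_eqF (pi_gt0 R)) implybT.
rewrite -powR12_sqrt ?pi_ge0// -powR_mulrn ?powR_ge0// -powRrM.
rewrite -powRD; last by rewrite (gt_eqF (pi_gt0 R)) implybT.
rewrite (_ : _ + _ = 0) ?powRr0//.
by field.
Qed.

Definition coherent (u : 'rV[C]_d) (y : 'rV[R]_d) : C :=
  coherent_cst * \prod_j coherent1 (u 0 j) (y 0 j).

Lemma bargmann_kernelE (z : 'rV[C]_d) (y : 'rV[R]_d) :
  cexp (- 2^-1 * (bil z z + (sqnorm y)%:C) + (Num.sqrt 2)%:C * bil z (vecC y)) =
  \prod_j bargmann_kernel1 (z 0 j) (y 0 j).
Proof.
rewrite -cexp_sum; congr cexp.
rewrite /bil /sqnorm rmorph_sum -big_split /= !mulr_sumr -big_split.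
apply: eq_bigr => j _; rewrite !mxE rmorphXn /=; congr (_ * _ + _).
Qed.

Lemma bargmann_prod (I : finType) (P : pred I) (k : I -> C)
    (W : I -> 'I_d -> R -> C) (B : I -> 'I_d -> C) (f : 'rV[R]_d -> C)
    (z : 'rV[C]_d) :
  (forall p j, let g := fun y => bargmann_kernel1 (z 0 j) y * W p j y in
     cintegrable mu g /\ cintegral mu g = (Num.sqrt pi)%:C * B p j) ->
  (forall y, f y = coherent_cst * \sum_(p | P p) k p * \prod_j W p j (y 0 j)) ->
  bargmann f z = \sum_(p | P p) k p * \prod_j B p j.
Proof.
move=> hW fE; rewrite /bargmann.
rewrite (@integralR_sum_prod I P (fun p => coherent_cst * k p)
  (fun p j y => bargmann_kernel1 (z 0 j) y * W p j y)).
- rewrite mulr_sumr; apply: eq_bigr => p _.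
  under eq_bigr do rewrite (hW p _).2.
  rewrite big_split /=; 
  transitivity (coherent_cst * coherent_cst *
    \prod_(j < d) (Num.sqrt pi)%:C * (k p * \prod_j B p j)); last first.
    by rewrite coherent_cstK mul1r.
  by rewrite -/coherent_cst; ring.
- by move=> p j; have [] := hW p j.
- move=> y; rewrite bargmann_kernelE fE mulrCA !mulr_sumr.
  by apply: eq_bigr => p _; rewrite [X in _ = _ * X]big_split /=; ring.
Qed.

(** With both exponents 0 the polynomial given by [bargmann1] is the constant 1, and the sum over
    monomials has a single term, indexed by [unit]. *)
Lemma bargmann_coherent (u z : 'rV[C]_d) :
  bargmann (coherent u) z = cexp (bil z u).
Proof.
have [V lV hV] := bargmann1 (leading_mon R 0 0).
rewrite (@bargmann_prod unit predT (fun=> 1) (fun _ j => coherent1 (u 0 j))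
  (fun _ j => cexp (z 0 j * u 0 j))).
- rewrite (big_pred1 tt); last by case.
  by rewrite mul1r -cexp_sum.
- move=> _ j /=; have := hV (z 0 j) (u 0 j); rewrite (leading00 lV).
  rewrite (_ : (fun y : R => bargmann_kernel1 _ _ * (_ * _)) = (fun y : R =>
    bargmann_kernel1 (z 0 j) y * coherent1 (u 0 j) y)) ?mulr1//.
  by apply/funext => y; rewrite !expr0 !mulr1.
- by move=> y; rewrite (big_pred1 tt) ?mul1r//; case.
Qed.

End Assembly.

(** * Both operators applied to an exponential *)

Section Transforms.
Variables (R : realType) (d N : nat).
Local Notation C := R[i].
Local Notation mu := (@lebesgue_measure R).
Local Notation i := ('i%C : C).

Let choice1 (A T : Type) (P Q : A -> T -> Prop) :
  (forall a, exists2 t, P a t & Q a t) ->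
  exists2 f : A -> T, forall a, P a (f a) & forall a, Q a (f a).
Proof.
move=> h; have h' a : exists t, P a t /\ Q a t by have [t] := h a; exists t.
by have [f hf] := choice h'; exists f => a; have [] := hf a.
Qed.

Let choice2 (A B T : Type) (P Q : A -> B -> T -> Prop) :
  (forall a b, exists2 t, P a b t & Q a b t) ->
  exists2 f : A -> B -> T, forall a b, P a b (f a b) &
    forall a b, Q a b (f a b).
Proof.
move=> h; have [f f1 f2] := @choice1 (A * B) T (fun p => P p.1 p.2)
  (fun p => Q p.1 p.2) (fun p => h p.1 p.2).
exists (fun a b => f (a, b)) => a b; [exact: (f1 (a, b))|exact: (f2 (a, b))].
Qed.

(** [V] depends on the exponents alone and is chosen ahead of [u] and [z], so the factor of the
    exponential is a genuine polynomial in [(z, u)]. *)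
Lemma bargmann_weyl_coherent (c : mindex d N -> mindex d N -> C) :
  exists2 V : nat -> nat -> C -> C -> C, forall m n, leading m n (V m n) &
  forall u z : 'rV[C]_d,
    bargmann (weyl_op (fun x xi => sum_le c (vecC x) (vecC xi)) (coherent u)) z
    = cexp (bil z u) * \sum_(p : mindex d N * mindex d N |
        (mlen p.1 + mlen p.2 <= N)%N)
      c p.1 p.2 * \prod_j V (p.1 j) (p.2 j)
        ((z 0 j + u 0 j) / sqrt2 R) (i * (z 0 j - u 0 j) / sqrt2 R).
Proof.
have [W lW hW] := choice2 (weyl1 R).
have [V lV hV] := choice2 (fun m n => bargmann1 (lW m n)).
exists V => //.
move=> u z.
pose inner m (x xi : R) (v : C) := cintegral mu (weyl_integrand1 m v x xi).
have weylE x : weyl_op (fun x xi => sum_le c (vecC x) (vecC xi)) (coherent u) x =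
    coherent_cst R d * \sum_(p : mindex d N * mindex d N |
        (mlen p.1 + mlen p.2 <= N)%N)
      c p.1 p.2 * \prod_j (coherent1 (u 0 j) (x 0 j) *
        W (p.1 j) (p.2 j) (x 0 j)%:C
          (i * ((x 0 j)%:C - sqrt2 R * u 0 j))).
  rewrite /weyl_op.
  rewrite (@integralR_sum_prod _ _ _ (fun p : mindex d N * mindex d N =>
      (mlen p.1 + mlen p.2 <= N)%N) (fun p => coherent_cst R d * c p.1 p.2)
    (fun p j xi => xi%:C ^+ p.2 j * inner (p.1 j) (x 0 j) xi (u 0 j))).
  - rewrite mulr_sumr [RHS]mulr_sumr; apply: eq_bigr => p _.
    rewrite mulrCA -mulrA; congr (_ * (_ * _)).
    transitivity ((((2 * pi) ^+ d)^-1)%:C * \prod_j ((2 * pi)%:C *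
      (coherent1 (u 0 j) (x 0 j) *
        W (p.1 j) (p.2 j) (x 0 j)%:C
          (i * ((x 0 j)%:C - sqrt2 R * u 0 j))))).
      congr (_ * _); apply: eq_bigr => j _.
      by have [_ _] := hW (p.1 j) (p.2 j) (x 0 j) (u 0 j).
    rewrite [X in _ * X]big_split /= prodr_const card_ord -rmorphXn mulrA.
    rewrite -rmorphM /= mulVf ?mul1r// expf_neq0//.
    by rewrite mulf_neq0// gt_eqF// pi_gt0.
  - move=> p j.
    by have [_] := hW (p.1 j) (p.2 j) (x 0 j) (u 0 j).
  - move=> xi.
    rewrite (@integralR_sum_prod _ _ _ (fun p : mindex d N * mindex d N =>
      (mlen p.1 + mlen p.2 <= N)%N)
      (fun p => coherent_cst R d * c p.1 p.2 *
         \prod_j (xi 0 j)%:C ^+ p.2 j)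
      (fun p j => weyl_integrand1 (p.1 j) (u 0 j) (x 0 j) (xi 0 j))).
    + by apply: eq_bigr => p _; rewrite [X in _ = _ * X]big_split /= mulrA.
    + move=> p j.
      by have [] := hW (p.1 j) (p.2 j) (x 0 j) (u 0 j).
    + move=> y; rewrite sum_le_pair /coherent.
      have -> : cexp ('i%C * bil (vecC (x - y)) (vecC xi)) =
          \prod_j cexp (i * (((x 0 j)%:C - (y 0 j)%:C) * (xi 0 j)%:C)).
        rewrite -cexp_sum /bil mulr_sumr; congr cexp.
        by apply: eq_bigr => j _; rewrite !mxE rmorphB.
      rewrite -mulrA mulr_suml; apply: eq_bigr => p _.
      under [X in _ * X * _]eq_bigr do rewrite !mxE.
      rewrite /weyl_integrand1 [X in _ = _ * X]big_split /=.
      rewrite [X in _ = _ * (X * _)]big_split [X in _ * X * _]big_split /=.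
      have -> : \prod_(j < d) (2^-1 * (x 0 j + y 0 j))%:C ^+ p.1 j =
          \prod_(j < d) (2^-1 * ((x 0 j)%:C + (y 0 j)%:C)) ^+ p.1 j.
        apply: eq_bigr => j _; congr (_ ^+ _).
        by rewrite rmorphM rmorphD fmorphV rmorph_nat.
      ring.
rewrite (@bargmann_prod _ _ _ (fun p : mindex d N * mindex d N =>
      (mlen p.1 + mlen p.2 <= N)%N) (fun p => c p.1 p.2)
   (fun p j y => coherent1 (u 0 j) y * W (p.1 j) (p.2 j) y%:C
          (i * (y%:C - sqrt2 R * u 0 j)))
   (fun p j => cexp (z 0 j * u 0 j) * V (p.1 j) (p.2 j)
      ((z 0 j + u 0 j) / sqrt2 R) (i * (z 0 j - u 0 j) / sqrt2 R))) //.
  rewrite mulr_sumr; apply: eq_bigr => p _.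
  by rewrite [X in _ * X = _]big_split /= -cexp_sum mulrCA.
move=> p j.
have [h1 h2] := hV (p.1 j) (p.2 j) (z 0 j) (u 0 j).
by rewrite mulrA.
Qed.

(** The powers of [z] pass through the integral, so averaging only affects the powers of the
    conjugate of [w], and [V] keeps its second slot at 0. Joint integrability, used for Fubini, will
    be supplied by the assignment. *)
Lemma wick_coherent (c : mindex d N -> mindex d N -> C) :
  exists2 V : nat -> C -> C -> C, forall n, leading n 0 (V n) &
  forall (b : 'rV[C]_d -> 'rV[C]_d -> C) (u z : 'rV[C]_d),
    (forall z w, b z w = sum_le c z (vconj w)) ->
    integrableC (wick_integrand b (fun w => cexp (bil w u)) z) ->
    wick_op b (fun w => cexp (bil w u)) z =
    cexp (bil z u) * \sum_(p : mindex d N * mindex d N |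
        (mlen p.1 + mlen p.2 <= N)%N)
      c p.1 p.2 * \prod_j (z 0 j ^+ p.1 j * V (p.2 j) (u 0 j) 0).
Proof.
have [V lV hV] := choice1 (wick1 R).
exists V => //.
move=> b u z bE bi.
pose P := (fun p : mindex d N * mindex d N => (mlen p.1 + mlen p.2 <= N)%N).
pose k (p : mindex d N * mindex d N) := c p.1 p.2 * \prod_j z 0 j ^+ p.1 j.
have intE (x y : d.-tuple (measurableTypeR R)) :
    wick_integrand b (fun w => cexp (bil w u)) z (vecReIm (rvec x) (rvec y)) =
    \sum_(p | P p) k p * \prod_j
      wick_integrand1 (p.2 j) (u 0 j) (z 0 j) (rvec x 0 j) (rvec y 0 j).
  move: (rvec x) (rvec y) => {}x {}y.
  rewrite /wick_integrand bE sum_le_pair -mulrA -cexpD mulr_suml.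
  apply: eq_bigr => p _; rewrite /k /wick_integrand1.
  rewrite [X in _ * X * _]big_split [X in _ = _ * X]big_split /=.
  rewrite -cexp_sum.
  have -> : \prod_(j < d) vconj (vecReIm x y) 0 j ^+ p.2 j =
      \prod_(j < d) ((x 0 j)%:C - i * (y 0 j)%:C) ^+ p.2 j.
    apply: eq_bigr => j _; rewrite !mxE; congr (_ ^+ _).
    by apply: complexP; rewrite !complex_partsE /=; ring.
  have -> : bil (vecReIm x y) u + herm (z - vecReIm x y) (vecReIm x y) =
      \sum_(j < d) (((x 0 j)%:C + i * (y 0 j)%:C) * u 0 j +
        (z 0 j - ((x 0 j)%:C + i * (y 0 j)%:C)) *
          ((x 0 j)%:C - i * (y 0 j)%:C)).
    rewrite /bil /herm -big_split; apply: eq_bigr => j _; rewrite !mxE.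
    by apply: complexP; rewrite /= !complex_partsE /=; ring.
  by ring.
have i1 (x : d.-tuple (measurableTypeR R)) (p : mindex d N * mindex d N) j :
    cintegrable mu (wick_integrand1 (p.2 j) (u 0 j) (z 0 j) (rvec x 0 j)).
  by have [] := hV (p.2 j) (z 0 j) (u 0 j).
have i2 (p : mindex d N * mindex d N) j : cintegrable mu (fun x =>
    cintegral mu (wick_integrand1 (p.2 j) (u 0 j) (z 0 j) x)).
  by have [] := hV (p.2 j) (z 0 j) (u 0 j).
rewrite /wick_op /integralC /lebesgueC cintegral_fubini//; last first.
  move=> x; have [+ _] := cintegral_lebesgue_tuple P k (i1 x).
  by congr cintegrable; apply/funext => y; rewrite intE.
have -> : (fun x : d.-tuple (measurableTypeR R) =>
    cintegral (@lebesgue_tuple R d) (fun y => wick_integrand b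
      (fun w => cexp (bil w u)) z (vecReIm (rvec x) (rvec y)))) =
    (fun x => \sum_(p | P p) k p * \prod_j
      cintegral mu (wick_integrand1 (p.2 j) (u 0 j) (z 0 j) (rvec x 0 j))).
  apply/funext => x; have [_ <-] := cintegral_lebesgue_tuple P k (i1 x).
  by congr cintegral; apply/funext => y; rewrite intE.
have [_ ->] := cintegral_lebesgue_tuple P k i2.
rewrite mulr_sumr [RHS]mulr_sumr; apply: eq_bigr => p _.
have -> : \prod_(j < d) cintegral mu (fun x =>
      cintegral mu (wick_integrand1 (p.2 j) (u 0 j) (z 0 j) x)) =
    (pi ^+ d)%:C * (cexp (bil z u) * \prod_j V (p.2 j) (u 0 j) 0).
  rewrite /bil cexp_sum -[X in _ = _ * X]big_split /=.
  have -> : (pi ^+ d)%:C = \prod_(j < d) pi%:C :> C.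
    by rewrite prodr_const card_ord rmorphXn.
  rewrite -[RHS]big_split /=; apply: eq_bigr => j _.
  have [_ _ ->] := hV (p.2 j) (z 0 j) (u 0 j).
  by rewrite mulrA.
have p0 : ((pi ^+ d)^-1)%:C * (pi ^+ d)%:C = 1 :> C.
  by rewrite -rmorphM /= mulVf// expf_neq0// gt_eqF// pi_gt0.
rewrite [X in _ = _ * (_ * X)]big_split /= /k.
rewrite -[RHS]mul1r -[X in _ = X * _]p0; ring.
Qed.

End Transforms.

(** * Coherent states are Schwartz functions *)

Section SchwartzCoherent.
Variables (R : realType) (d : nat).
Local Notation C := R[i].
Local Notation Re := (@complex.Re R).
Local Notation Im := (@complex.Im R).
Implicit Types (f g : 'rV[R]_d -> R) (x : 'rV[R]_d).

(** Differentiability is bundled with a closed form of the partial derivatives, since these have to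
    be differentiated again. *)
Definition has_grad f (df : 'I_d -> 'rV[R]_d -> R) := forall x,
  differentiable f x /\ forall j, 'D_(delta_mx 0 j) f x = df j x.

Lemma has_grad_cst (k : R) : has_grad (fun=> k) (fun _ _ => 0).
Proof.
by move=> x; split; [exact: differentiable_cst|move=> j; exact: derive_cst].
Qed.

Lemma has_grad_coord k :
  has_grad (fun y => y 0 k) (fun j _ => (j == k)%:R).
Proof.
pose h (y : 'rV[R]_d) : R := y 0 k.
have hlin : linear h by move=> a u v; rewrite /h !mxE.
pose hL : {linear 'rV[R]_d -> R} := HB.pack h (GRing.isLinear.Build _ _ _ _ _ hlin).
have hc : continuous hL by exact: coord_continuous.
move=> x; have dh : differentiable h x by exact: differentiable_coord.
split=> // j; rewrite deriveE// (diff_lin _ hc) /= /h mxE eqxx /=.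
by rewrite eq_sym.
Qed.

Lemma has_gradD f g df dg : has_grad f df -> has_grad g dg ->
  has_grad (fun y => f y + g y) (fun j y => df j y + dg j y).
Proof.
move=> fd gd x; have [f1 f2] := fd x; have [g1 g2] := gd x.
split; first exact: differentiableD.
by move=> j; rewrite deriveD ?f2 ?g2//; exact: diff_derivable.
Qed.

Lemma has_gradM f g df dg : has_grad f df -> has_grad g dg ->
  has_grad (fun y => f y * g y) (fun j y => df j y * g y + f y * dg j y).
Proof.
move=> fd gd x; have [f1 f2] := fd x; have [g1 g2] := gd x.
split; first exact: differentiableM.
move=> j; rewrite deriveM ?f2 ?g2//; try exact: diff_derivable.
by rewrite /GRing.scale /= addrC [g x * _]mulrC.
Qed.

Lemma has_grad_comp (h dh : R -> R) f df :
  (forall y : R, is_derive y 1 h (dh y)) -> has_grad f df ->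
  has_grad (fun y => h (f y)) (fun j y => dh (f y) * df j y).
Proof.
move=> hd fd x; have [f1 f2] := fd x.
have h1 : differentiable h (f x).
  by apply/derivable1_diffP; have [] := hd (f x).
have hf : differentiable (h \o f) x by exact: differentiable_comp.
split=> // j; rewrite deriveE//.
rewrite -[fun y => h (f y)]/(h \o f) diff_comp// diff1E//=.
rewrite -deriveE// f2 derive1E; have [_ ->] := hd (f x).
by rewrite /GRing.scale /= mulrC.
Qed.

Lemma has_grad_sum (r : seq 'I_d) (F : 'I_d -> 'rV[R]_d -> R) dF :
  (forall k, has_grad (F k) (dF k)) ->
  has_grad (fun y => \sum_(k <- r) F k y) (fun j y => \sum_(k <- r) dF k j y).
Proof.
move=> Fd; elim: r => [|k r IH].
  move=> x; have := has_grad_cst 0 x.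
  rewrite (_ : (fun y => \sum_(k <- [::]) F k y) = fun=> 0).
    by under [in X in _ -> X]eq_forall do rewrite big_nil.
  by apply/funext => y; rewrite big_nil.
move=> x; have := has_gradD (Fd k) IH x.
rewrite (_ : (fun y => \sum_(k <- k :: r) F k y) =
  (fun y => F k y + \sum_(k <- r) F k y)).
  by under [in X in _ -> X]eq_forall do rewrite big_cons.
by apply/funext => y; rewrite big_cons.
Qed.

Definition affine (q : 'I_d -> R) (r : R) (y : 'rV[R]_d) : R :=
  \sum_j q j * y 0 j + r.

Lemma has_grad_affine q r : has_grad (affine q r) (fun j _ => q j).
Proof.
move=> x; have := has_gradD (has_grad_sum (index_enum 'I_d) (fun k =>
  has_gradM (has_grad_cst (q k)) (has_grad_coord k))) (has_grad_cst r) x.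
move=> [h1 h2]; split => // j; rewrite h2 addr0 (bigD1 j)//= eqxx mulr1 mul0r.
rewrite add0r big1 ?addr0// => k kj.
by rewrite mul0r add0r eq_sym (negbTE kj) mulr0.
Qed.

(** A class stable under partial derivatives, of polynomial growth, and containing the oscillating
    factors of the real and imaginary parts of a coherent state. *)
Inductive trigpoly : ('rV[R]_d -> R) -> Prop :=
| trigpoly_cst k : trigpoly (fun=> k)
| trigpoly_coord j : trigpoly (fun y => y 0 j)
| trigpoly_cos q r : trigpoly (fun y => cos (affine q r y))
| trigpoly_sin q r : trigpoly (fun y => sin (affine q r y))
| trigpolyD f g : trigpoly f -> trigpoly g -> trigpoly (fun y => f y + g y)
| trigpolyM f g : trigpoly f -> trigpoly g -> trigpoly (fun y => f y * g y).

Lemma trigpoly_grad f : trigpoly f ->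
  exists2 df, has_grad f df & forall j, trigpoly (df j).
Proof.
elim=> {f} [k|j|q r|q r|f g _ [df fd tf] _ [dg gd tg]|
  f g tpf [df fd tf] tpg [dg gd tg]].
- exists (fun _ _ => 0); first exact: has_grad_cst.
  by move=> j; exact: trigpoly_cst.
- exists (fun k _ => (k == j)%:R); first exact: has_grad_coord.
  by move=> k; exact: trigpoly_cst.
- exists (fun j y => - sin (affine q r y) * q j).
    exact: (has_grad_comp (fun y => is_derive_cos y) (has_grad_affine q r)).
  move=> j; apply: trigpolyM; last exact: trigpoly_cst.
  rewrite (_ : (fun y => _) = (fun y => -1 * sin (affine q r y))).
    by apply: trigpolyM; [exact: trigpoly_cst|exact: trigpoly_sin].
  by apply/funext => y; rewrite mulN1r.
- exists (fun j y => cos (affine q r y) * q j).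
    exact: (has_grad_comp (fun y => is_derive_sin y) (has_grad_affine q r)).
  by move=> j; apply: trigpolyM; [exact: trigpoly_cos|exact: trigpoly_cst].
- exists (fun j y => df j y + dg j y); first exact: has_gradD.
  by move=> j; exact: trigpolyD.
- exists (fun j y => df j y * g y + f y * dg j y); first exact: has_gradM.
  by move=> j; apply: trigpolyD; exact: trigpolyM.
Qed.

Lemma sqnorm_ge0 x : 0 <= sqnorm x.
Proof. by apply: sumr_ge0 => j _; exact: sqr_ge0. Qed.

Lemma le_sqnorm x j : x 0 j ^+ 2 <= sqnorm x.
Proof.
by rewrite /sqnorm (bigD1 j)//= lerDl sumr_ge0// => k _; exact: sqr_ge0.
Qed.

Lemma trigpoly_bound f : trigpoly f -> exists K, exists2 m : nat,
  0 <= K & forall x, `|f x| <= K * (1 + sqnorm x) ^+ m.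
Proof.
have ge1 x m : 1 <= (1 + sqnorm x) ^+ m.
  by rewrite exprn_ege1// lerDl sqnorm_ge0.
have ge0 x m : 0 <= (1 + sqnorm x) ^+ m by rewrite (le_trans ler01).
elim=> {f} [k|j|q r|q r|f g _ [K [m K0 hf]] _ [L [n L0 hg]]|
  f g _ [K [m K0 hf]] _ [L [n L0 hg]]].
- by exists `|k|, 0%N => // x; rewrite mulr1.
- exists 1, 1%N => // x; rewrite mul1r expr1.
  have := le_sqnorm x j; have := sqr_ge0 (`|x 0 j| - 1).
  rewrite sqrrB1 real_normK ?num_real// => h1 h2.
  have := normr_ge0 (x 0 j); move: h1 h2.
  by rewrite -[_ *+ 2]mulr_natr; lra.
- by exists 1, 0%N => // x; rewrite mulr1 ler_norml cos_geN1 cos_le1.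
- by exists 1, 0%N => // x; rewrite mulr1 ler_norml sin_geN1 sin_le1.
- exists (K + L), (m + n)%N; first exact: addr_ge0.
  move=> x; rewrite (le_trans (ler_normD _ _))// mulrDl lerD//.
    rewrite (le_trans (hf x))// ler_wpM2l// exprD ler_peMr//.
  by rewrite (le_trans (hg x))// ler_wpM2l// exprD ler_peMl.
- exists (K * L), (m + n)%N; first exact: mulr_ge0.
  move=> x; rewrite normrM exprD mulrACA ler_pM//.
Qed.

Variable p : 'I_d -> R.

Definition gauss (y : 'rV[R]_d) : R := expR (- 2^-1 * sqnorm y + affine p 0 y).

Lemma gauss_grad : has_grad gauss (fun j y => gauss y * (p j - y 0 j)).
Proof.
have h : has_grad (fun y => - 2^-1 * sqnorm y + affine p 0 y)
    (fun j y => p j - y 0 j).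
  have := has_gradD (has_gradM (has_grad_cst (- 2^-1))
    (has_grad_sum (index_enum 'I_d) (fun k => has_gradM (has_grad_coord k)
    (has_grad_coord k)))) (has_grad_affine p 0).
  move=> H x; have [h1 h2] := H x; split => // j.
  rewrite [LHS]h2.
  rewrite mul0r add0r (bigD1 j)//= eqxx big1 => [|k kj].
    by rewrite mulr1 mul1r; field.
  by rewrite eq_sym (negbTE kj) mulr0 mul0r addr0.
exact: (has_grad_comp (fun y => is_derive_expR y) h).
Qed.

(** Of the exponent [- |x|^2 / 2], one half absorbs the power of [1 + |x|^2] and the other half
    absorbs the linear form, by [p x <= x^2 / 4 + p^2] in each coordinate. *)
Lemma gauss_decay m : exists K, 0 <= K /\ forall x,
  (1 + sqnorm x) ^+ m * gauss x <= K.
Proof.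
(* With [S = |x|^2]: [a <= 1] gives [a (1 + S) <= 1 + a S <= exp (a S)], and [a m <= 1 / 4] bounds
   the [m]-th power of the latter by [exp (S / 4)]. The successor keeps the denominator nonzero. *)
pose a : R := (4 * m.+1%:R)^-1.
have a0 : 0 < a by rewrite invr_gt0 mulr_gt0.
have a1 : a <= 1.
  by rewrite invf_le1 ?mulr_gt0// -[4]/(4%:R) -natrM ler1n.
exists (a^-1 ^+ m * expR (\sum_j p j ^+ 2)); split.
  by rewrite mulr_ge0 ?expR_ge0// exprn_ge0// invr_ge0 ltW.
have c0 : 0 <= a^-1 ^+ m by rewrite exprn_ge0// invr_ge0 ltW.
move=> x; have S0 := sqnorm_ge0 x.
have h1 : (1 + sqnorm x) ^+ m <= a^-1 ^+ m * expR (sqnorm x / 4).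
  apply: (@le_trans _ _ (a^-1 ^+ m * expR (a * sqnorm x) ^+ m)).
    rewrite -exprMn lerXn2r ?nnegrE ?addr_ge0//.
      by rewrite mulr_ge0 ?expR_ge0// invr_ge0 ltW.
    rewrite mulrC ler_pdivlMr//; apply: le_trans (expR_ge1Dx _).
    by rewrite mulrDl mul1r lerD// mulrC.
  rewrite ler_wpM2l//.
  rewrite -expRM_natr ler_expR mulrAC [sqnorm x / 4]mulrC ler_wpM2r//.
  rewrite /a invfM -mulrA ler_piMr ?invr_ge0//.
  by rewrite mulrC ler_pdivrMr// mul1r ler_nat.
have h2 : affine p 0 x <= sqnorm x / 4 + \sum_j p j ^+ 2.
  rewrite /affine addr0 /sqnorm mulr_suml -big_split ler_sum// => j _ /=.
  have := sqr_ge0 (x 0 j / 2 - p j); rewrite sqrrB.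
  by rewrite expr_div_n -[_ *+ 2]mulr_natr; lra.
apply: le_trans (ler_wpM2r (expR_ge0 _) h1) _.
rewrite -mulrA -expRD ler_wpM2l//.
by rewrite ler_expR; lra.
Qed.

(** Differentiating [gauss] in direction [j] brings down the affine factor [p j - y j], so the
    Gaussian always factors out unchanged. *)
Lemma partial_gauss f s : trigpoly f -> exists2 g, trigpoly g &
  partial s (fun y => f y * gauss y) = (fun y => g y * gauss y).
Proof.
move=> tf; elim: s => [|j s [g tg gE]]; first by exists f.
have [dg gd tdg] := trigpoly_grad tg.
exists (fun y => dg j y + g y * (p j + (-1) * y 0 j)).
  apply: trigpolyD => //; apply: trigpolyM => //; apply: trigpolyD.
    exact: trigpoly_cst.
  by apply: trigpolyM; [exact: trigpoly_cst|exact: trigpoly_coord].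
rewrite /= gE; apply/funext => x.
have [_ ->] := has_gradM gd gauss_grad x; ring.
Qed.

Lemma schwartzR_trigpoly f : trigpoly f -> schwartzR (fun y => f y * gauss y).
Proof.
move=> tf s; have [g tg ->] := partial_gauss s tf.
have [dg gd _] := trigpoly_grad tg.
split; first by move=> x; have [] := has_gradM gd gauss_grad x.
move=> k; have [K [m K0 gK]] := trigpoly_bound tg.
have [L [L0 hL]] := gauss_decay (k + m); exists (K * L) => x.
have S0 := sqnorm_ge0 x.
have s1 : Num.sqrt (1 + sqnorm x) <= 1 + sqnorm x.
  rewrite -{2}[1 + sqnorm x]sqr_sqrtr ?addr_ge0// expr2 ler_peMl ?sqrtr_ge0//.
  by rewrite -[X in X <= _]sqrtr1 ler_sqrt ?lerDl ?addr_ge0.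
apply: (@le_trans _ _ ((1 + sqnorm x) ^+ k *
    (K * (1 + sqnorm x) ^+ m * gauss x))).
  apply: ler_pM => //.
    by rewrite lerXn2r// ?nnegrE ?sqrtr_ge0 ?addr_ge0.
  by rewrite normrM (ger0_norm (expR_ge0 _)) ler_wpM2r// expR_ge0.
rewrite -mulrA mulrCA ler_wpM2l//.
by rewrite mulrA -exprD.
Qed.

End SchwartzCoherent.

(** * Exponentials are entire *)

Section EntireExponential.
Local Open Scope classical_set_scope.

(* The library topologizes a [numFieldType] but not the concrete type [R[i]]:
   complex differentiability of [cexp] is obtained by instantiating [K]. *)
Lemma exponential_differentiable (K : numFieldType) (E : K -> K) (M : K) :
  (forall x y, E (x + y) = E x * E y) -> 0 <= M ->
  (forall h, `|h| <= 1 -> `|E h - 1 - h| <= M * `|h| ^+ 2) ->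
  forall x, differentiable (E : K -> K^o) x.
Proof.
move=> ED M0 Eh x; apply/derivable1_diffP/cvg_ex; exists (E x).
apply/cvgrPdist_le => /= e e0.
(* The added 1 keeps [B] positive even if [E x] or [M] vanishes. *)
pose B := `|E x| * M + 1.
have B0 : 0 < B by rewrite ltr_wpDl// mulr_ge0.
near=> h.
have h0 : h != 0 by near: h; exact: nbhs_dnbhs_neq.
have h1 : `|h| <= 1 by near: h; apply: dnbhs0_le.
have h2 : `|h| <= e / B by near: h; apply: dnbhs0_le; rewrite divr_gt0.
(* By multiplicativity the difference quotient at [x] is [E x] times the one at 0, where the
   derivative is 1. *)
have -> : E x - h^-1 *: (E (h *: 1 + x) - E x) =
    - (E x * h^-1 * (E h - 1 - h)).
  by rewrite [h *: 1]mulr1 addrC ED /GRing.scale /= mulrC; field.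
rewrite normrN !normrM.
apply: (@le_trans _ _ (`|E x| * `|h^-1| * (M * `|h| ^+ 2))).
  by rewrite ler_wpM2l ?mulr_ge0// Eh.
have -> : `|E x| * `|h^-1| * (M * `|h| ^+ 2) = `|E x| * M * `|h|.
  by rewrite normfV; field; rewrite normr_eq0.
apply: (@le_trans _ _ (B * `|h|)); first by rewrite ler_wpM2r// lerDl.
by rewrite mulrC -ler_pdivlMr.
Unshelve. all: by end_near. Qed.

Lemma entire_linear_comp (K : numFieldType) n (E : K -> K) (u : 'rV[K]_n) :
  (forall x, differentiable (E : K -> K^o) x) ->
  entire (fun z : 'rV[K]_n => E (\sum_j z 0 j * u 0 j)).
Proof.
move=> dE z.
have dl : differentiable (fun z : 'rV[K]_n => \sum_j z 0 j * u 0 j : K^o) z.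
  have -> : (fun z : 'rV[K]_n => \sum_j z 0 j * u 0 j : K^o) =
      \sum_j (fun z : 'rV[K]_n => z 0 j * u 0 j : K^o).
    by apply/funext => w; rewrite fct_sumE.
  apply: differentiable_sum => j.
  apply: differentiableM; last exact: differentiable_cst.
  exact: differentiable_coord.
exact: (differentiable_comp dl (dE _)).
Qed.

End EntireExponential.

(** * Taylor estimate for the exponential; admissibility of coherent states *)

Section CoherentState.
Variables (R : realType) (d : nat).
Local Notation C := R[i].
Local Notation Re := (@complex.Re R).
Local Notation Im := (@complex.Im R).
Local Notation normc := (@ComplexField.Normc.normc R).

Lemma normr_normc (z : C) : `|z| = (normc z)%:C.
Proof. by rewrite normc_def; case: z. Qed.

(** The mean value theorem fails for complex values; it is applied to real and imaginary parts
    separately, which costs the factor 2. *)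
Lemma cderive_bound (f df : R -> C) (B : R) :
  (forall t, is_cderive t f (df t)) ->
  (forall t, 0 <= t <= 1 -> normc (df t) <= B) ->
  normc (f 1 - f 0) <= 2 * B.
Proof.
move=> fd dfB.
have mvt (g dg : R -> R) : (forall t : R, is_derive t 1 g (dg t)) ->
    (forall t, `|dg t| <= normc (df t)) -> `|g 1 - g 0| <= B.
  move=> gd dgB; have [|t t01 ->] := @MVT R g dg 0 1 ltr01 (fun t _ => gd t).
    apply: derivable_within_continuous => t _.
    by have [] := gd t.
  rewrite subr0 mulr1 (le_trans (dgB t))// dfB//.
  by move: t01; rewrite in_itv/= => /andP[/ltW -> /ltW].
rewrite (le_trans (normc_le _))// !complex_partsE mulr_natl mulr2n lerD//.
  apply: (mvt (fun t => Re (f t)) (fun t => Re (df t))) => t.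
    by have [] := fd t.
  exact: normRe_le.
apply: (mvt (fun t => Im (f t)) (fun t => Im (df t))) => t.
  by have [] := fd t.
exact: normIm_le.
Qed.

(** [cderive_bound] is used twice along a segment from 0: on [e^(t w)], for a first-order bound,
    then on [e^(t h) - 1 - t h], whose derivative [h (e^(t h) - 1)] is controlled by that bound.
    Each use contributes a factor 2, and [expR 1] bounds the exponential on the unit disc. *)
Lemma cexp_taylor (h : C) : normc h <= 1 ->
  normc (cexp h - 1 - h) <= 4 * expR 1 * normc h ^+ 2.
Proof.
move=> h1.
have line (w : C) t : is_cderive t (fun t => t%:C * w) w.
  have := is_cderive_affine t 0 w.
  by rewrite (_ : (fun t => 0 + _) = (fun t => t%:C * w))//;
    apply/funext => s; rewrite add0r.
have first (w : C) : normc w <= 1 -> normc (cexp w - 1) <= 2 * expR 1 * normc w.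
  move=> w1; have := @cderive_bound (fun t => cexp (t%:C * w))
    (fun t => w * cexp (t%:C * w)) (expR 1 * normc w).
  rewrite mul1r mul0r cexp0 mulrA; apply.
    by move=> t; exact: is_cderive_cexp.
  move=> t /andP[t0 t1]; rewrite ComplexField.Normc.normcM mulrC.
  rewrite ler_wpM2r ?normc_ge0// normc_cexp ler_expR.
  apply: (le_trans (ler_norm _)); apply: (le_trans (normRe_le _)).
  by rewrite ComplexField.Normc.normcM normc_real ger0_norm// mulr_ile1// normc_ge0.
have := @cderive_bound (fun t => cexp (t%:C * h) + (- 1 + (- h) * t%:C))
    (fun t => h * (cexp (t%:C * h) - 1)) (2 * expR 1 * normc h ^+ 2).
rewrite mul1r mul0r cexp0 mulr1 mulr0 addr0 subrr subr0 addrA mulrA mulrA.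
rewrite -natrM; apply.
  move=> t; have : is_cderive t (fun t : R => -1 + (- h) * t%:C) (- h).
    have := is_cderive_affine t (-1) (- h).
    by under eq_fun do rewrite mulrC.
  move=> /(is_cderiveD (is_cderive_cexp (line h t))) /is_cderive_eq; apply.
  by ring.
move=> t /andP[t0 t1]; rewrite ComplexField.Normc.normcM.
have th : normc (t%:C * h) <= normc h.
  rewrite ComplexField.Normc.normcM normc_real ger0_norm//.
  by rewrite ler_piMl// normc_ge0.
rewrite mulrC expr2 mulrA ler_wpM2r ?normc_ge0//.
apply: (le_trans (first _ (le_trans th h1))).
by rewrite ler_wpM2l// mulr_ge0// expR_ge0.
Qed.

Lemma cexp_bil_entire (u : 'rV[C]_d) : entire (fun z => cexp (bil z u)).
Proof.
apply: (entire_linear_comp (E := @cexp R)).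
apply: (@exponential_differentiable _ _ (4 * expR 1)%:C (@cexpD R)).
  by rewrite ler0c mulr_ge0// expR_ge0.
move=> h; rewrite !normr_normc -rmorphXn -rmorphM -[1]/(1%:C) !lecR.
exact: cexp_taylor.
Qed.

Lemma cexp_bil_entire_exp (u : 'rV[C]_d) :
  entire_exp (fun z => cexp (bil z u)).
Proof.
split; first exact: cexp_bil_entire.
(* The added 1 makes the rate positive also when [u = 0]. *)
exists (\sum_j normc (u 0 j) + 1).
  by rewrite ltr_wpDl// sumr_ge0// => j _; exact: normc_ge0.
exists 1 => z; rewrite mul1r normr_normc lecR normc_cexp ler_expR.
have nz0 : 0 <= normC2 z by exact: sqrtr_ge0.
have nz j : normc (z 0 j) <= normC2 z.
  rewrite -(@ler_pXn2r _ 2) ?nnegrE ?normc_ge0// sqr_normc sqr_sqrtr.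
    rewrite lerD//; first by rewrite (le_trans _ (le_sqnorm _ j))// mxE.
    by rewrite (le_trans _ (le_sqnorm _ j))// mxE.
  by rewrite addr_ge0// sqnorm_ge0.
have h : normc (bil z u) <= \sum_j normc (z 0 j * u 0 j).
  rewrite /bil; elim/big_rec2: _ => [|j a b _ ab].
    by rewrite ComplexField.Normc.normc0.
  by rewrite (le_trans (le_normcD _ _))// lerD2l.
apply: (le_trans (ler_norm _)); apply: (le_trans (normRe_le _)).
apply: (le_trans h); rewrite mulrDl mul1r ler_wpDr// mulr_suml ler_sum// => j _.
by rewrite ComplexField.Normc.normcM mulrC ler_wpM2l// normc_ge0.
Qed.

(** Modulus and phase are separated: [Re u] gives the linear term of the real exponent, [Im u] the
    frequency of the oscillation. *)
Lemma coherentE (u : 'rV[C]_d) y :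
  let q v := affine (fun j => Num.sqrt 2 * v (u 0 j)) in
  coherent u y = coherent_cst R d *
  cexp ((- 2^-1 * sqnorm y + q Re 0 y + - 2^-1 * \sum_j Re (u 0 j ^+ 2))
        +i* q Im (- 2^-1 * \sum_j Im (u 0 j ^+ 2)) y).
Proof.
move=> q; rewrite /coherent /coherent1 -cexp_sum; congr (_ * cexp _).
have ReS (F : 'I_d -> C) : Re (\sum_j F j) = \sum_j Re (F j).
  by apply: (big_morph Re (@ReD R)).
have ImS (F : 'I_d -> C) : Im (\sum_j F j) = \sum_j Im (F j).
  by apply: (big_morph Im (@ImD R)).
have half : 2^-1 = (2^-1 : R)%:C :> C by rewrite fmorphV rmorph_nat.
rewrite /q /affine /sqnorm addr0 !mulr_sumr -!big_split /=.
apply: complexP; rewrite ?ReS ?ImS /=; apply: eq_bigr => j _.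
  by rewrite half /sqrt2 !expr2 !complex_partsE /=; ring.
by rewrite half /sqrt2 !expr2 !complex_partsE /=; ring.
Qed.

Lemma coherent_schwartz (u : 'rV[C]_d) : schwartz (coherent u).
Proof.
pose p j := Num.sqrt 2 * Re (u 0 j).
pose k := pi `^ (- (d%:R / 4)) * expR (- 2^-1 * \sum_j Re (u 0 j ^+ 2)) : R.
(* Real and imaginary parts are treated at once: [pr] is the projection and [t] the matching cosine
   or sine. *)
have h (t : R -> R) (pr : C -> R) :
    (forall q r, trigpoly (fun y : 'rV[R]_d => t (affine q r y))) ->
    (forall a b, pr (coherent_cst R d * cexp (a +i* b)) =
       pi `^ (- (d%:R / 4)) * expR a * t b) ->
    schwartzR (pr \o coherent u).
  move=> tq prE.
  rewrite (_ : pr \o _ = fun y => k * t (affine (fun j =>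
    Num.sqrt 2 * Im (u 0 j)) (- 2^-1 * \sum_j Im (u 0 j ^+ 2)) y) * gauss p y).
    by apply: schwartzR_trigpoly; apply: trigpolyM => //; exact: trigpoly_cst.
  apply/funext => y /=; rewrite coherentE prE expRD /k /gauss /p.
  by ring.
split; [apply: (h cos)|apply: (h sin)].
- exact: trigpoly_cos.
- by move=> a b; rewrite /cexp /coherent_cst !complex_partsE /=; ring.
- exact: trigpoly_sin.
- by move=> a b; rewrite /cexp /coherent_cst !complex_partsE /=; ring.
Qed.

Lemma coherent_preimage (u : 'rV[C]_d) :
  bargmann_preimage (fun z => cexp (bil z u)) (coherent u).
Proof.
by split; [exact: coherent_schwartz|apply/funext => z; exact: bargmann_coherent].
Qed.

End CoherentState.

(** * Top coefficients *)

Section TopCoefficient.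
Variable R : realType.
Local Notation C := R[i].
Implicit Types f g : C -> C.

(** The coefficient [a] of [t^k] may vanish: with degree at most [k] only, the notion is compatible
    with sums and products, and lower-order terms simply contribute 0. *)
Definition topcoef k f (a : C) := exists P : {poly C},
  [/\ (size P <= k.+1)%N, P`_k = a & forall t, f t = P.[t]].

(** In characteristic 0 the natural numbers provide more roots than a nonzero difference of
    polynomials can have. *)
Lemma topcoef_uniq k f a b : topcoef k f a -> topcoef k f b -> a = b.
Proof.
move=> [P [_ <- fP]] [Q [_ <- fQ]]; suff -> : P = Q by [].
apply/eqP; rewrite -subr_eq0; apply/negPn/negP => PQ0.
pose s : seq C := [seq n%:R | n <- iota 0 (size (P - Q))].
have us : uniq s.
  rewrite map_inj_uniq ?iota_uniq// => m n /eqP.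
  by rewrite eqr_nat => /eqP.
have rs : all (root (P - Q)) s.
  apply/allP => t _; rewrite /root hornerD hornerN -fP -fQ subrr.
  exact: eqxx.
by have := max_poly_roots PQ0 rs us; rewrite size_map size_iota ltnn.
Qed.

Lemma eq_topcoef k f g a : f =1 g -> topcoef k f a -> topcoef k g a.
Proof. by move=> fg [P [sP Pk fP]]; exists P; split => // t; rewrite -fg. Qed.

Lemma topcoef0 k : topcoef k (fun=> 0) 0.
Proof. by exists 0; rewrite size_poly0 coef0; split => // t; rewrite horner0. Qed.

Lemma topcoefD k f g a b : topcoef k f a -> topcoef k g b ->
  topcoef k (fun t => f t + g t) (a + b).
Proof.
move=> [P [sP <- fP]] [Q [sQ <- fQ]]; exists (P + Q); split.
- by rewrite (leq_trans (size_polyD _ _))// geq_max sP.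
- by rewrite coefD.
- by move=> t; rewrite hornerD fP fQ.
Qed.

Lemma topcoefZ k c f a : topcoef k f a -> topcoef k (fun t => c * f t) (c * a).
Proof.
move=> [P [sP <- fP]]; exists (c *: P); split.
- exact: leq_trans (size_scale_leq _ _) sP.
- by rewrite coefZ.
- by move=> t; rewrite hornerZ fP.
Qed.

Lemma topcoef_lt k m f a : (m < k)%N -> topcoef m f a -> topcoef k f 0.
Proof.
move=> mk [P [sP _ fP]]; exists P; split => //.
  by rewrite (leq_trans sP)// ltnW.
by rewrite nth_default// (leq_trans sP).
Qed.

Lemma topcoefM k m f g a b : topcoef k f a -> topcoef m g b ->
  topcoef (k + m) (fun t => f t * g t) (a * b).
Proof.
move=> [P [sP <- fP]] [Q [sQ <- fQ]]; exists (P * Q); split.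
- rewrite (leq_trans (size_polyMleq _ _))// -subn1 leq_subLR add1n.
  by rewrite (leq_trans (leq_add sP sQ))// addSn addnS.
- have kk : (k < (k + m).+1)%N by rewrite ltnS leq_addr.
  rewrite coefM (bigD1 (Ordinal kk))//= addKn big1 ?addr0// => j jk.
  have [kj|jk'] := ltnP k j.
    by rewrite nth_default ?mul0r// (leq_trans sP).
  rewrite [X in _ * X]nth_default ?mulr0// (leq_trans sQ)//.
  have {}jk : (j < k)%N.
    by rewrite ltn_neqAle jk' andbT; apply: contra jk => /eqP e; apply/eqP/val_inj.
  by rewrite ltn_subRL ltn_add2r.
- by move=> t; rewrite hornerM fP fQ.
Qed.

Lemma topcoefX m A : topcoef m (fun t => (t * A) ^+ m) (A ^+ m).
Proof.
exists (A ^+ m *: 'X^m); split.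
- by rewrite (leq_trans (size_scale_leq _ _))// size_polyXn.
- by rewrite coefZ coefXn eqxx mulr1.
- by move=> t; rewrite hornerZ hornerXn exprMn mulrC.
Qed.

(** At [(t A, t B)] a term of total degree [e] is a multiple of [t^e], so the remainder does not
    reach [t^(m + n)]. *)
Lemma topcoef_leading m n Q A B : leading m n Q ->
  topcoef (m + n) (fun t => Q (t * A) (t * B)) (A ^+ m * B ^+ n).
Proof.
move=> [l lN lE]; rewrite -[A ^+ m * B ^+ n]addr0.
have lead := topcoefM (topcoefX m A) (topcoefX n B).
suff low : topcoef (m + n)
    (fun t => \sum_(s <- l) s.1 * ((t * A) ^+ s.2.1 * (t * B) ^+ s.2.2)) 0.
  by apply: eq_topcoef (topcoefD lead low) => t; rewrite -lE addrC subrK.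
elim: l lN {lE} => [_|s l IH /= /andP[sN lN]].
  by apply: eq_topcoef (topcoef0 _) => t; rewrite big_nil.
have hs : topcoef (m + n)
    (fun t => s.1 * ((t * A) ^+ s.2.1 * (t * B) ^+ s.2.2)) 0.
  apply: topcoef_lt sN (topcoefZ _ _).
  exact: topcoefM (topcoefX _ A) (topcoefX _ B).
have := topcoefD hs (IH lN); rewrite addr0; apply: eq_topcoef => t.
by rewrite big_cons.
Qed.

Lemma topcoef_prod (I : Type) (r : seq I) (k : I -> nat) (f : I -> C -> C) a :
  (forall i, topcoef (k i) (f i) (a i)) ->
  topcoef (\sum_(i <- r) k i) (fun t => \prod_(i <- r) f i t)
    (\prod_(i <- r) a i).
Proof.
move=> fa; elim: r => [|i r IH].
  rewrite !big_nil; exists 1; rewrite size_poly1 coef1; split => // t.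
  by rewrite big_nil hornerC.
rewrite !big_cons; apply: eq_topcoef (topcoefM (fa i) IH) => t.
by rewrite big_cons.
Qed.

Lemma topcoef_sum (I : finType) (k : I -> nat) N (c : I -> C) (f : I -> C -> C) a :
  (forall i, topcoef (k i) (f i) (a i)) ->
  topcoef N (fun t => \sum_(i | (k i <= N)%N) c i * f i t)
    (\sum_(i | k i == N) c i * a i).
Proof.
move=> fa; rewrite [X in topcoef _ _ X]big_mkcond /=.
have h i : topcoef N (fun t => if (k i <= N)%N then c i * f i t else 0)
    (if k i == N then c i * a i else 0).
  have [kN|kN|<-] := ltngtP (k i) N.
  - exact: topcoef_lt kN (topcoefZ (c i) (fa i)).
  - exact: topcoef0.
  - exact: topcoefZ.
suff : forall r : seq I, topcoef N
    (fun t => \sum_(i <- r) if (k i <= N)%N then c i * f i t else 0)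
    (\sum_(i <- r) if k i == N then c i * a i else 0).
  move=> /(_ (index_enum I)); apply: eq_topcoef => t.
  by rewrite [RHS]big_mkcond.
elim=> [|i r IH].
  by rewrite big_nil; apply: eq_topcoef (topcoef0 _) => t; rewrite big_nil.
rewrite big_cons; apply: eq_topcoef (topcoefD (h i) IH) => t.
by rewrite big_cons.
Qed.

End TopCoefficient.

(** * Comparison of the homogeneous parts of degree [N] *)

Section PrincipalSymbol.
Variables (R : realType) (d N : nat).
Local Notation C := R[i].
Local Notation i := ('i%C : C).

(** After cancellation of [e^(z.u)] both sides are polynomials in [(z, u)]. Evaluated at
    [(t z, t u)] they have the two homogeneous parts as coefficients of [t^N], whatever the
    remainders in [V] and [V']. *)
Lemma assignment_top (c c' : mindex d N -> mindex d N -> C) b :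
  bargmann_assignment (fun x xi => sum_le c (vecC x) (vecC xi)) b ->
  (forall z w, b z w = sum_le c' z (vconj w)) ->
  forall z u : 'rV[C]_d, sum_top c' z u =
    sum_top c ((sqrt2 R)^-1 *: (z + u)) ((i / sqrt2 R) *: (z - u)).
Proof.
move=> [_ hb] bE z u.
have [V lV hV] := bargmann_weyl_coherent c.
have [V' lV' hV'] := wick_coherent c'.
have {hb} key : forall z u : 'rV[C]_d,
    \sum_(p : mindex d N * mindex d N | (mlen p.1 + mlen p.2 <= N)%N)
      c' p.1 p.2 * \prod_j (z 0 j ^+ p.1 j * V' (p.2 j) (u 0 j) 0) =
    \sum_(p : mindex d N * mindex d N | (mlen p.1 + mlen p.2 <= N)%N)
      c p.1 p.2 * \prod_j V (p.1 j) (p.2 j)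
        ((z 0 j + u 0 j) / sqrt2 R) (i * (z 0 j - u 0 j) / sqrt2 R).
  move=> {}z {}u; have [bi bw] := hb _ (cexp_bil_entire_exp u).
  have := congr1 (@^~ z) (bw _ (coherent_preimage u)).
  rewrite (hV' b u z bE (bi z)) hV.
  by move=> /(mulfI (cexp_neq0 _)).
have klen (p : mindex d N * mindex d N) :
    (\sum_j (p.1 j + p.2 j))%N = (mlen p.1 + mlen p.2)%N.
  by rewrite big_split.
rewrite !sum_top_pair.
pose f (p : mindex d N * mindex d N) (t : C) :=
  \prod_j ((t * z 0 j) ^+ p.1 j * V' (p.2 j) (t * u 0 j) 0).
pose g (p : mindex d N * mindex d N) (t : C) :=
  \prod_j V (p.1 j) (p.2 j) (t * ((sqrt2 R)^-1 *: (z + u)) 0 j)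
     (t * ((i / sqrt2 R) *: (z - u)) 0 j).
have tf p : topcoef (mlen p.1 + mlen p.2) (f p)
    (\prod_j (z 0 j ^+ p.1 j * u 0 j ^+ p.2 j)).
  rewrite -klen; apply: topcoef_prod => j.
  apply: topcoefM; first exact: topcoefX.
  have := topcoef_leading (u 0 j) 0 (lV' (p.2 j)).
  by rewrite addn0 expr0 mulr1; apply: eq_topcoef => t; rewrite mulr0.
have tg p : topcoef (mlen p.1 + mlen p.2) (g p)
    (\prod_j (((sqrt2 R)^-1 *: (z + u)) 0 j ^+ p.1 j *
      ((i / sqrt2 R) *: (z - u)) 0 j ^+ p.2 j)).
  by rewrite -klen; apply: topcoef_prod => j; exact: topcoef_leading.
apply: topcoef_uniq (topcoef_sum N (fun p => c' p.1 p.2) tf) _.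
apply: eq_topcoef (topcoef_sum N (fun p => c p.1 p.2) tg) => t.
have := key (t *: z) (t *: u); under eq_bigr do under eq_bigr do rewrite !mxE.
move=> ->; apply: eq_bigr => p _; congr (_ * _); apply: eq_bigr => j _.
by rewrite !mxE; congr (V _ _ _ _); ring.
Qed.

End PrincipalSymbol.

(** * Ellipticity *)

Section Ellipticity.
Variables (R : realType) (d N : nat).
Local Notation C := R[i].
Local Notation i := ('i%C : C).
Local Notation normc := (@ComplexField.Normc.normc R).
Implicit Types (x xi : 'rV[R]_d) (z : 'rV[C]_d).

Definition japanese x xi : R := Num.sqrt (1 + norm2 x xi ^+ 2).

Lemma japanese_ge1 x xi : 1 <= japanese x xi.
Proof.
rewrite -[X in X <= _]sqrtr1 ler_sqrt ?lerDl ?sqr_ge0//.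
by rewrite addr_ge0// sqr_ge0.
Qed.

Lemma norm2_le_japanese x xi : norm2 x xi <= japanese x xi.
Proof.
have n0 : 0 <= norm2 x xi by exact: sqrtr_ge0.
rewrite -[X in X <= _](ger0_norm n0) -sqrtr_sqr ler_sqrt ?lerDr//.
by rewrite addr_ge0// sqr_ge0.
Qed.

Lemma coord_le_japanese x xi j :
  `|x 0 j| <= japanese x xi /\ `|xi 0 j| <= japanese x xi.
Proof.
have S0 := addr_ge0 (sqnorm_ge0 x) (sqnorm_ge0 xi).
have e2 : norm2 x xi ^+ 2 = sqnorm x + sqnorm xi by rewrite sqr_sqrtr.
split; apply: le_trans (norm2_le_japanese _ _);
  rewrite -(@ler_pXn2r _ 2) ?nnegrE ?sqrtr_ge0// e2 real_normK ?num_real//.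
  by rewrite (le_trans (le_sqnorm x j))// lerDl sqnorm_ge0.
by rewrite (le_trans (le_sqnorm xi j))// lerDr sqnorm_ge0.
Qed.

Lemma normc_monomial x xi (p : mindex d N * mindex d N) :
  normc (\prod_j (vecC x 0 j ^+ p.1 j * vecC xi 0 j ^+ p.2 j)) <=
  japanese x xi ^+ (mlen p.1 + mlen p.2).
Proof.
have J0 : 0 <= japanese x xi by exact: sqrtr_ge0.
have -> : (mlen p.1 + mlen p.2 = \sum_j (p.1 j + p.2 j))%N.
  by rewrite big_split.
elim/big_rec2: _ => [|j n w _ IH].
  by rewrite ComplexField.Normc.normc1 expr0.
have [h1 h2] := coord_le_japanese x xi j.
rewrite ComplexField.Normc.normcM exprD ler_pM ?normc_ge0//.
rewrite ComplexField.Normc.normcM !normcX exprD !mxE !normc_real.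
by rewrite ler_pM ?exprn_ge0// lerXn2r ?nnegrE.
Qed.

(** [omega N] is the [N]-th power of [japanese], so monomials of degree below [N] gain one order.
    Writing the gain as a factor on the left avoids the exponent [N - 1], hence a separate case
    [N = 0]. *)
Lemma lower_order (c : mindex d N -> mindex d N -> C) : exists2 K, 0 <= K &
  forall x xi, normc (sum_le c (vecC x) (vecC xi) -
                      sum_top c (vecC x) (vecC xi)) * japanese x xi
    <= K * omega N x xi.
Proof.
pose P (p : mindex d N * mindex d N) := (mlen p.1 + mlen p.2 < N)%N.
exists (\sum_(p | P p) normc (c p.1 p.2)).
  by apply: sumr_ge0 => p _; exact: normc_ge0.
move=> x xi; have J0 : 0 <= japanese x xi by exact: sqrtr_ge0.
rewrite sum_le_pair sum_top_pair.
rewrite (bigID (fun p : mindex d N * mindex d N =>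
  (mlen p.1 + mlen p.2 == N)%N)) /=.
rewrite [X in X + _ - _](eq_bigl (fun p : mindex d N * mindex d N =>
  (mlen p.1 + mlen p.2 == N)%N)); last first.
  by move=> p; case: eqP => [->|]; rewrite ?leqnn ?andbF.
rewrite addrAC subrr add0r.
rewrite (eq_bigl P); last by move=> p; rewrite /P ltn_neqAle andbC.
rewrite -[omega N x xi]/(japanese x xi ^+ N) mulr_suml.
apply: (@le_trans _ _ (\sum_(p | P p)
    normc (c p.1 p.2 * \prod_j (vecC x 0 j ^+ p.1 j * vecC xi 0 j ^+ p.2 j)) *
    japanese x xi)).
  rewrite -mulr_suml ler_wpM2r//.
  elim/big_rec2: _ => [|p s w _ IH]; first by rewrite ComplexField.Normc.normc0.
  by rewrite (le_trans (le_normcD _ _))// lerD2l.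
apply: ler_sum => p Pp; rewrite ComplexField.Normc.normcM -mulrA.
rewrite ler_wpM2l ?normc_ge0//.
apply: le_trans (ler_wpM2r J0 (normc_monomial x xi p)) _.
by rewrite -exprSr ler_weXn2l// japanese_ge1.
Qed.

(** Beyond radius [2 K / k] the error is at most half of the lower bound [k omega]. The smallness
    condition is symmetric in [f] and [g], so the lemma serves both directions. *)
Lemma elliptic_Sh_perturb (f g : 'rV[R]_d -> 'rV[R]_d -> C) (K : R) : 0 <= K ->
  (forall x xi, normc (f x xi - g x xi) * japanese x xi <= K * omega N x xi) ->
  elliptic_Sh (omega N) f -> elliptic_Sh (omega N) g.
Proof.
move=> K0 fg [r r0 [k k0 fk]].
exists (Num.max r (2 * K / k)); first by rewrite lt_max r0.
exists (k / 2); first by rewrite divr_gt0.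
move=> x xi; rewrite ge_max => /andP[rx Kx].
have := fk _ _ rx; rewrite !normr_normc !lecR => fx.
have J1 := japanese_ge1 x xi; have J0 : 0 < japanese x xi by apply: lt_le_trans J1.
have O0 : 0 <= omega N x xi by rewrite exprn_ge0// sqrtr_ge0.
have KJ : 2 * K <= k * japanese x xi.
  rewrite [leRHS]mulrC -ler_pdivrMr//.
  exact: le_trans Kx (norm2_le_japanese _ _).
have fgx : normc (f x xi - g x xi) <= k / 2 * omega N x xi.
  rewrite -(ler_pM2r J0); apply: le_trans (fg x xi) _.
  rewrite mulrAC ler_wpM2r//; lra.
have := le_normcD (f x xi - g x xi) (g x xi); rewrite subrK => tri.
by move: (omega N x xi) O0 fx fgx => w *; lra.
Qed.

(** The point at which [elliptic_A] evaluates its weight, read as [x + i xi] in phase space. *)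
Definition phase_point z : 'rV[C]_d := (Num.sqrt 2)%:C *: vconj z.

Lemma norm2_phase_point z :
  norm2 (vecRe (phase_point z)) (vecIm (phase_point z)) =
  Num.sqrt 2 * normC2 z.
Proof.
rewrite /normC2 /norm2 -sqrtrM//; congr Num.sqrt.
rewrite /sqnorm -!big_split mulr_sumr /=; apply: eq_bigr => j _.
rewrite !mxE; case: (z 0 j) => a b /=.
rewrite !mul0r subr0 addr0 !exprMn sqr_sqrtr// sqrrN; ring.
Qed.

Lemma phase_point_surj x xi : exists z,
  vecRe (phase_point z) = x /\ vecIm (phase_point z) = xi.
Proof.
have s0 : Num.sqrt 2 != 0 :> R by rewrite sqrtr_eq0 -ltNge.
exists (vecReIm ((Num.sqrt 2)^-1 *: x) (- ((Num.sqrt 2)^-1 *: xi))).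
split; apply/rowP => j; rewrite !mxE /=.
  by rewrite mul0r subr0 mulrA divff// mul1r.
by rewrite mul0r addr0 opprK mulrA divff// mul1r.
Qed.

End Ellipticity.

(** * Formula for the principal symbol, ellipticity and positivity *)

Theorem theorem6p10 (R : realType) (d N : nat)
    (c : mindex d N -> mindex d N -> R[i])
    (a : 'rV[R]_d -> 'rV[R]_d -> R[i])
    (ha : a = fun x xi => sum_le c (vecC x) (vecC xi))
    (ap : 'rV[R]_d -> 'rV[R]_d -> R[i])
    (hap : ap = fun x xi => sum_top c (vecC x) (vecC xi))
    (b : 'rV[R[i]]_d -> 'rV[R[i]]_d -> R[i])
    (hb : bargmann_assignment a b)
    (bp : 'rV[R[i]]_d -> 'rV[R[i]]_d -> R[i])
    (hbp : principal_symbol N b bp) :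
  [/\ forall z w, bp z w =
        (2 `^ (- (N%:R / 2)))%:C *
        \sum_al \sum_(be | (mlen al + mlen be == N)%N)
          c al be * 'i%C ^+ mlen be
          * mpow (z + vconj w) al * mpow (z - vconj w) be,
      elliptic_Sh (omega N) a <-> elliptic_A (omega N) bp &
      (forall x xi, (x, xi) != (0, 0) -> 0 < ap x xi) <->
      (forall z, z != 0 -> 0 < bp z z)].
Proof.
subst a ap; have [c' [bE bpE]] := hbp.
have bpT z w : bp z w = sum_top c ((sqrt2 R)^-1 *: (z + vconj w))
    (('i%C / sqrt2 R) *: (z - vconj w)).
  by rewrite bpE (assignment_top hb bE).
have s2 := sqrt2_neq0 R.
(* On the diagonal the two arguments are [sqrt 2 Re z] and [- sqrt 2 Im z], the real and imaginary
   parts of [sqrt 2] times the conjugate of [z]. *)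
have diag z : bp z z = sum_top c (vecC (vecRe (phase_point z)))
    (vecC (vecIm (phase_point z))).
  rewrite bpT; congr sum_top; apply/rowP => j; rewrite !mxE;
    apply: (mulfI s2).
    rewrite mulVKf//; case: (z 0 j) => u v.
    have := sqr_sqrtr (ler0n R 2); rewrite /sqrt2 => e.
    by apply: complexP; rewrite !complex_partsE /=; ring: e.
  rewrite mulrA mulrCA mulfV// mulr1; case: (z 0 j) => u v.
  have := sqr_sqrtr (ler0n R 2); rewrite /sqrt2 => e.
  by apply: complexP; rewrite !complex_partsE /=; ring: e.
split.
- move=> z w; rewrite bpT /sum_top mulr_sumr; apply: eq_bigr => al _.
  rewrite mulr_sumr; apply: eq_bigr => be /eqP ab.
  have mpowZ k (v : 'rV[R[i]]_d) (m : mindex d N) :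
      mpow (k *: v) m = k ^+ mlen m * mpow v m.
    rewrite /mpow /mlen expr_sum -big_split; apply: eq_bigr => j _ /=.
    by rewrite mxE exprMn.
  (* Since only terms of length exactly [N] occur, the prefactor splits into one [1 / sqrt 2] per
     linear factor. *)
  have -> : (2 `^ (- (N%:R / 2)))%:C = (sqrt2 R)^-1 ^+ (mlen al + mlen be).
    rewrite ab exprVn -rmorphXn -fmorphV; congr (_%:C).
    rewrite powRN; congr (_^-1); rewrite mulrC powRrM powR12_sqrt//.
    by rewrite powR_mulrn// sqrtr_ge0.
  by rewrite !mpowZ exprD exprMn; ring.
- have [K K0 hK] := lower_order c.
  (* The full symbol is replaced by its top part, the one that [diag] relates to [bp]. *)
  have -> : elliptic_Sh (omega N) (fun x xi => sum_le c (vecC x) (vecC xi)) <->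
      elliptic_Sh (omega N) (fun x xi => sum_top c (vecC x) (vecC xi)).
    split; apply: (elliptic_Sh_perturb K0) => x xi //.
    by rewrite -normcN opprB.
  have q0 : 0 < Num.sqrt 2 :> R by rewrite sqrtr_gt0.
  split=> -[r r0 [k k0 hk]].
    (* The same radius works because [sqrt 2 |z| >= |z|]; in the other direction it is scaled by
       [sqrt 2]. *)
    exists r => //; exists k => // z rz /=; rewrite diag; apply: hk.
    rewrite norm2_phase_point (le_trans rz)// ler_peMl ?sqrtr_ge0//.
    by rewrite -[X in X <= _]sqrtr1 ler_sqrt// ler1n.
  exists (Num.sqrt 2 * r); first by rewrite mulr_gt0.
  exists k => // x xi rx; have [z [zx zxi]] := phase_point_surj x xi.
  move: rx; rewrite -zx -zxi norm2_phase_point ler_pM2l// => rz.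
  by have := hk z rz; rewrite /= diag.
(* [phase_point] is onto and vanishes only at 0, so [diag] matches nonzero points with nonzero
   points. *)
- split=> pos.
    move=> z z0; rewrite diag; apply: pos; apply: contra z0 => /eqP[zx zxi].
    apply/eqP/rowP => j; rewrite mxE.
    have /rowP/(_ j) := zx; have /rowP/(_ j) := zxi; rewrite !mxE.
    have q0 : Num.sqrt 2 != 0 :> R by rewrite sqrtr_eq0 -ltNge.
    case: (z 0 j) => u v /=; rewrite !mul0r subr0 addr0.
    move=> /eqP; rewrite mulf_eq0 (negbTE q0) oppr_eq0 => /eqP ->.
    by move=> /eqP; rewrite mulf_eq0 (negbTE q0) => /eqP ->.
  move=> x xi x0; have [z [zx zxi]] := phase_point_surj x xi.
  rewrite -zx -zxi -diag; apply: pos; apply: contra x0 => /eqP z0.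
  by rewrite -zx -zxi z0; apply/eqP; congr pair; apply/rowP => j;
    rewrite !mxE /= !(mul0r, mulr0, oppr0, addr0, subr0).
Qed.
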